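(* Let $\varGamma_{\operatorname{par}}$ be a tropical curve with parallel rays and $K=\operatorname{Rat}(\varGamma_{\operatorname{par}})$. Two points $P$ and $Q$ at infinity of $\operatorname{CSpec}(K)$ are contained in the same prime congruence on $K$ of Type I-1 if and only if $\varphi^{-1}(P)$ and $\varphi^{-1}(Q)$ are contained in parallel rays of $\varGamma_{\operatorname{par}}$.
   Context: Tropical curves. Graphs are finite, connected, nonempty, undirected multigraphs, loops allowed. A leaf edge is a non-loop edge incident to a vertex that is incident to no other edge. An (abstract) tropical curve $\varGamma$ is the topological space obtained from a graph $G$ and a length function $l:E(G)\to\boldsymbol{R}_{>0}\cup\{\infty\}$, infinite only on leaf edges, by identifying each edge $e$ with $[0,l(e)]$ (the end $\infty$ being at a leaf end); $[0,\infty]$ is the one-point compactification of $[0,\infty)$. Such $(G,l)$ is a model of $\varGamma$. Points corresponding to $\infty$ are points at infinity, the others finite points. A ray of $\varGamma$ is the closed subset corresponding to an edge of infinite length in some model. A rational function on $\varGamma$ is a continuous map $f:\varGamma\to\boldsymbol{R}\cup\{\pm\infty\}$ that is either identically $-\infty$ or piecewise affine with integer slopes and finitely many pieces, taking values $\pm\infty$ only at points at infinity. $\operatorname{Rat}(\varGamma)$ is the set of rational functions with $f\oplus g=\max\{f,g\}$, $f\odot g=f+g$ pointwise (extended continuously to points at infinity). A tropical curve with parallel rays $\varGamma_{\operatorname{par}}$ is a tropical curve $\varGamma$ with an equivalence relation on its rays (equivalent rays are called parallel) such that two rays, one contained in the other, are equivalent. Its points are those of $\varGamma$; $\varGamma_{\operatorname{par},\infty}$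 is the set of points at infinity. $\operatorname{Rat}(\varGamma_{\operatorname{par}})\subset\operatorname{Rat}(\varGamma)$ consists of $-\infty$ and all $f\in\operatorname{Rat}(\varGamma)$ having the same slope at infinity along any two parallel rays. It is a semifield and a $\boldsymbol{T}$-algebra, where $\boldsymbol{T}=\boldsymbol{R}\cup\{-\infty\}$ is the tropical semifield ($\oplus=\max$, $\odot=+$). Congruences. A congruence on a semiring $S$ is an equivalence relation $C\subset S\times S$ compatible with addition and multiplication; it is prime if $C\ne S\times S$ and $(a\cdot c+b\cdot d,a\cdot d+b\cdot c)\in C$ implies $(a,b)\in C$ or $(c,d)\in C$. $\operatorname{CSpec}(S)$ is the set of prime congruences on $S$. $\operatorname{Ker}(\psi)=\{(a,b)\mid\psi(a)=\psi(b)\}$. Types. On the tropical Laurent polynomial semiring $\boldsymbol{T}[Y^{\pm}]$ consider the pairs $(a_1\odot Y^{\odot m_1}\oplus a_2\odot Y^{\odot m_2},\ a_1\odot Y^{\odot m_1})$, $a_i\in\boldsymbol{R}$, $m_i\in\boldsymbol{Z}$. $P(Z(1))$ is the congruence generated by those with $m_1\ge m_2$; $P(U(1,0;2))$ is the congruence generated by those with $m_1>m_2$, or $m_1=m_2$ and $a_1\ge a_2$. A prime congruence $P$ on $K$ is of Type F-1 (a finite point of $\operatorname{CSpec}(K)$) if $K/P\cong\boldsymbol{T}$, of Type I-1 if $K/P\cong\boldsymbol{T}[Y^{\pm}]/P(Z(1))$, and of Type I-2 (a point at infinity of $\operatorname{CSpec}(K)$) if $K/P\cong\boldsymbol{T}[Y^{\pm}]/P(U(1,0;2))$,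 as $\boldsymbol{T}$-algebras. $X\subset\operatorname{CSpec}(K)$ is the set of primes of Type F-1 or I-2, and $\varphi:\varGamma_{\operatorname{par}}\to X$ is the bijection sending a finite point $x$ to $\operatorname{Ker}(K\to\boldsymbol{T};f\mapsto f(x))$ and a point $x$ at infinity to $P_x=\{(f,g)\in K^2\mid f|_U=g|_U\text{ for some neighborhood }U\text{ of }x\}$. *)

(* Defs.v *)
From HB Require Import structures.
From Stdlib Require Import RelationClasses.
From mathcomp Require Import all_boot all_order all_algebra.
From mathcomp Require Import finmap.
From mathcomp Require Import generic_quotient.
From mathcomp Require Import all_classical all_reals ereal topology normedtype.

Set Implicit Arguments.
Unset Strict Implicit.
Unset Printing Implicit Defensive.
Import Order.TTheory GRing.Theory Num.Theory.
Local Open Scope classical_set_scope.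
Local Open Scope ring_scope.

(* Isomorphism of algebras over a semiring.  It is not stated for the library's
   comSemiAlgType because the quotient by the improper congruence is the zero
   algebra, which that structure excludes; only the semiring and scaling
   structures of A and B are needed. *)
Notation "A '\isoalg' B" :=
  (exists f : {rmorphism A -> B}, bijective f /\ scalable f)
  (at level 70).

Record congruence (S : comPzSemiRingType) := Congruence {
  congr_set :> set (S * S);
  congr_refl : forall x, congr_set (x, x);
  congr_sym : forall x y, congr_set (x, y) -> congr_set (y, x);
  congr_trans : forall y x z,
    congr_set (x, y) -> congr_set (y, z) -> congr_set (x, z);
  congrD : forall x y x' y', congr_set (x, y) -> congr_set (x', y') ->
    congr_set (x + x', y + y');
  congrM : forall x y x' y', congr_set (x, y) -> congr_set (x', y') ->
    congr_set (x * x', y * y') }.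

Definition prime_congruence (S : comPzSemiRingType) (C : congruence S) : Prop :=
  C <> [set: S * S] :> set (S * S) /\
  forall a b c d : S, congr_set C (a * c + b * d, a * d + b * c) ->
    congr_set C (a, b) \/ congr_set C (c, d).

Definition Ker (A : Type) (B : Type) (psi : A -> B) : set (A * A) :=
  [set p | psi p.1 = psi p.2].

(* The smallest congruence containing G. *)
Program Definition congr_gen (S : comPzSemiRingType) (G : set (S * S)) :
    congruence S :=
  @Congruence S [set p | forall C : congruence S, G `<=` C -> congr_set C p] _ _ _ _ _.
Next Obligation. by move=> S G x C _; exact: congr_refl. Qed.
Next Obligation. by move=> S G x y H C GC; apply/congr_sym/H. Qed.
Next Obligation.
by move=> S G y x z H1 H2 C GC; apply: (congr_trans (H1 C GC) (H2 C GC)).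
Qed.
Next Obligation.
by move=> S G x y x' y' H1 H2 C GC; apply: (congrD (H1 C GC) (H2 C GC)).
Qed.
Next Obligation.
by move=> S G x y x' y' H1 H2 C GC; apply: (congrM (H1 C GC) (H2 C GC)).
Qed.

Section Quotient.
Variables (R : pzSemiRingType) (S : comSemiAlgType R) (C : congruence S).
Local Open Scope quotient_scope.

Definition congr_bool : rel S := fun x y => `[< congr_set C (x, y) >].

Lemma congr_bool_refl : reflexive congr_bool.
Proof. by move=> x; apply/asboolP; exact: congr_refl. Qed.
Lemma congr_bool_sym : symmetric congr_bool.
Proof. by move=> x y; apply/asboolP/asboolP; exact: congr_sym. Qed.
Lemma congr_bool_trans : transitive congr_bool.
Proof.
by move=> y x z /asboolP xy /asboolP yz; apply/asboolP; exact: congr_trans yz.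
Qed.
Canonical congr_equiv :=
  EquivRel congr_bool congr_bool_refl congr_bool_sym congr_bool_trans.

Definition quot : Type := {eq_quot congr_equiv}.
HB.instance Definition _ := Choice.on quot.
HB.instance Definition _ := EqQuotient.on quot.

Definition qpi (x : S) : quot := \pi_quot x.

Lemma qpiP x y : qpi x = qpi y <-> congr_set C (x, y).
Proof.
split; first by move/eqmodP/asboolP.
by move=> /asboolP h; apply/eqmodP.
Qed.

Lemma qpi_repr (x : quot) : qpi (repr x) = x.
Proof. exact: reprK. Qed.

Lemma repr_qpi x : congr_set C (repr (qpi x), x).
Proof. by apply/qpiP; rewrite qpi_repr. Qed.

Definition qzero := qpi 0.
Definition qone := qpi 1.
Definition qadd (x y : quot) := qpi (repr x + repr y).
Definition qmul (x y : quot) := qpi (repr x * repr y).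
Definition qscale (a : R) (x : quot) := qpi (a *: repr x).

Lemma qaddE x y : qadd (qpi x) (qpi y) = qpi (x + y).
Proof. by apply/qpiP/congrD; exact: repr_qpi. Qed.
Lemma qmulE x y : qmul (qpi x) (qpi y) = qpi (x * y).
Proof. by apply/qpiP/congrM; exact: repr_qpi. Qed.
Lemma qscaleE a x : qscale a (qpi x) = qpi (a *: x).
Proof.
apply/qpiP; have scaleE (y : S) : a *: y = (a *: 1) * y.
  by rewrite -scalerAl mul1r.
by rewrite [a *: repr _]scaleE [a *: x]scaleE; apply: congrM; [exact: congr_refl|exact: repr_qpi].
Qed.

Lemma qpi_ind (Q : quot -> Prop) : (forall x, Q (qpi x)) -> forall x, Q x.
Proof. by move=> H x; rewrite -(qpi_repr x); exact: H. Qed.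

Lemma qaddA : associative qadd.
Proof.
by elim/qpi_ind=> x; elim/qpi_ind=> y; elim/qpi_ind=> z; rewrite !qaddE addrA.
Qed.
Lemma qaddC : commutative qadd.
Proof. by elim/qpi_ind=> x; elim/qpi_ind=> y; rewrite !qaddE addrC. Qed.
Lemma qadd0 : left_id qzero qadd.
Proof. by elim/qpi_ind=> x; rewrite !qaddE add0r. Qed.
HB.instance Definition _ := GRing.isNmodule.Build quot qaddA qaddC qadd0.
Lemma qpiD x y : qpi (x + y) = qpi x + qpi y.
Proof. by rewrite [RHS]qaddE. Qed.

Lemma qmulA : associative qmul.
Proof.
by elim/qpi_ind=> x; elim/qpi_ind=> y; elim/qpi_ind=> z; rewrite !qmulE mulrA.
Qed.
Lemma qmulC : commutative qmul.
Proof. by elim/qpi_ind=> x; elim/qpi_ind=> y; rewrite !qmulE mulrC. Qed.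
Lemma qmul1 : left_id qone qmul.
Proof. by elim/qpi_ind=> x; rewrite !qmulE mul1r. Qed.
Lemma qmulDl : left_distributive qmul qadd.
Proof.
elim/qpi_ind=> x; elim/qpi_ind=> y; elim/qpi_ind=> z.
by rewrite [qadd (qpi x) _]qaddE !qmulE qaddE mulrDl.
Qed.
Lemma qmul0 : left_zero qzero qmul.
Proof. by elim/qpi_ind=> x; rewrite !qmulE mul0r. Qed.
HB.instance Definition _ := GRing.Nmodule_isComPzSemiRing.Build quot
  qmulA qmulC qmul1 qmulDl qmul0.

Lemma qscaleA a b v : qscale a (qscale b v) = qscale (a * b) v.
Proof. by elim/qpi_ind: v => v; rewrite !qscaleE scalerA. Qed.
Lemma qscale0 v : qscale 0 v = 0.
Proof. by elim/qpi_ind: v => v; rewrite !qscaleE scale0r. Qed.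
Lemma qscale1 : left_id 1 qscale.
Proof. by elim/qpi_ind=> v; rewrite !qscaleE scale1r. Qed.
Lemma qscaleDr : right_distributive qscale +%R.
Proof.
move=> a; elim/qpi_ind=> u; elim/qpi_ind=> v.
by rewrite -qpiD !qscaleE -qpiD scalerDr.
Qed.
Lemma qscaleDl v : {morph qscale^~ v : a b / a + b}.
Proof.
by elim/qpi_ind: v => v a b; rewrite !qscaleE -qpiD scalerDl.
Qed.
HB.instance Definition _ := GRing.Nmodule_isLSemiModule.Build R quot
  qscaleA qscale0 qscale1 qscaleDr qscaleDl.

End Quotient.

Section Laurent.
Variable S : comNzSemiRingType.

(* Laurent polynomials over S, as finitely supported coefficient functions on
   int with the convolution product.  lmono a m is the monomial a Y^m. *)
Record laurent := Laurent {
  lcoef :> int -> S;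
  lcoef_fin : finite_set [set n | lcoef n != 0] }.

HB.instance Definition _ := gen_eqMixin laurent.
HB.instance Definition _ := gen_choiceMixin laurent.

Lemma laurent_eq (f g : laurent) : (forall n, f n = g n) -> f = g.
Proof.
case: f g => f ff [g gf] /= /funext fg; rewrite fg in ff *.
by congr Laurent; exact: Prop_irrelevance.
Qed.

Definition lsupp (f : laurent) : {fset int} := fset_set [set n | f n != 0].

Lemma lsuppP (f : laurent) n : n \notin lsupp f -> f n = 0.
Proof.
rewrite in_fset_set; last exact: lcoef_fin.
by move=> /negP; rewrite inE /= => /negP; rewrite negbK => /eqP.
Qed.

Definition lmul_fun (f g : int -> S) (n : int) : S :=
  \sum_(i \in [set: int]) f i * g (n - i).

Lemma lmul_funE (f : laurent) (g : int -> S) n :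
  lmul_fun f g n = \sum_(i <- lsupp f) f i * g (n - i).
Proof. by apply: fsbigTE => i /lsuppP ->; rewrite mul0r. Qed.

Lemma lmul_funC f g n : lmul_fun f g n = lmul_fun g f n.
Proof.
rewrite /lmul_fun (@reindex_fsbigT _ _ _ _ _ (fun i : int => n - i)).
  by apply: eq_fsbigr => i _; rewrite opprB [n + (i - n)]addrC subrK mulrC.
by exists (fun i : int => n - i) => i; rewrite opprB addrC subrK.
Qed.

Lemma lzero_fin : finite_set [set n : int | (0 : S) != 0].
Proof. by apply: (@sub_finite_set _ _ set0) => // n; rewrite /= eqxx. Qed.
Definition lzero := @Laurent (fun=> 0) lzero_fin.

Lemma ladd_fin (f g : laurent) : finite_set [set n | f n + g n != 0].
Proof.
apply: (@sub_finite_set _ _ ([set n | f n != 0] `|` [set n | g n != 0])).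
  move=> n /= ; case: (eqVneq (f n) 0) => [->|]; last by left.
  by rewrite add0r; right.
by rewrite finite_setU; split; exact: lcoef_fin.
Qed.
Definition ladd f g := Laurent (ladd_fin f g).

Lemma lmul_fin (f g : laurent) : finite_set [set n | lmul_fun f g n != 0].
Proof.
apply: (@sub_finite_set _ _ [set i + j | i in [set n | f n != 0] &
    j in [set n | g n != 0]]); last first.
  by apply: finite_image2; exact: lcoef_fin.
move=> n /= fg; apply: contrapT => nfg; move/eqP: fg; apply.
rewrite /lmul_fun; apply: fsbig1 => i _.
case: (eqVneq (f i) 0) => [->|fi]; first by rewrite mul0r.
case: (eqVneq (g (n - i)) 0) => [->|gi]; first by rewrite mulr0.
by exfalso; apply: nfg; exists i => //; exists (n - i) => //; rewrite addrC subrK.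
Qed.
Definition lmul f g := Laurent (lmul_fin f g).

Definition lmono_fun (a : S) (m : int) : int -> S :=
  fun n => if n == m then a else 0.
Lemma lmono_fin a m : finite_set [set n | lmono_fun a m n != 0].
Proof.
apply: (@sub_finite_set _ _ [set m]); last exact: finite_set1.
by move=> n /=; rewrite /lmono_fun; case: (n =P m) => // _; rewrite eqxx.
Qed.
Definition lmono a m := Laurent (lmono_fin a m).

Lemma laddA : associative ladd.
Proof. by move=> f g h; apply: laurent_eq => n /=; rewrite addrA. Qed.
Lemma laddC : commutative ladd.
Proof. by move=> f g; apply: laurent_eq => n /=; rewrite addrC. Qed.
Lemma ladd0 : left_id lzero ladd.
Proof. by move=> f; apply: laurent_eq => n /=; rewrite add0r. Qed.
HB.instance Definition _ := GRing.isNmodule.Build laurent laddA laddC ladd0.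

Lemma lcoefD (f g : laurent) n : (f + g) n = f n + g n.
Proof. by []. Qed.

Lemma lmulC : commutative lmul.
Proof. by move=> f g; apply: laurent_eq => n /=; exact: lmul_funC. Qed.

Lemma lmulA : associative lmul.
Proof.
move=> f g h; rewrite (lmulC g h) [RHS]lmulC; apply: laurent_eq => n /=.
rewrite !lmul_funE.
under eq_bigr do rewrite /= lmul_funE big_distrr /=.
under [RHS]eq_bigr do rewrite /= lmul_funE big_distrr /=.
rewrite exchange_big; apply: eq_bigr => k _; apply: eq_bigr => i _.
by rewrite mulrCA addrAC.
Qed.

Lemma lscale_funE a m (f : int -> S) n : lmul_fun (lmono a m) f n = a * f (n - m).
Proof.
rewrite /lmul_fun (fsbigTE [fset m]%fset).
  by rewrite big_seq_fset1 /= /lmono_fun eqxx.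
by move=> i; rewrite inE => /negbTE /= im; rewrite /lmono_fun im mul0r.
Qed.

Lemma lmul1 : left_id (lmono 1 0) lmul.
Proof.
by move=> f; apply: laurent_eq => n; rewrite [LHS]lscale_funE mul1r subr0.
Qed.
Lemma lone_neq0 : lmono 1 0 != lzero.
Proof.
apply/eqP => /(congr1 (fun f : laurent => f 0)) /=; rewrite /lmono_fun eqxx.
by move/eqP; rewrite oner_eq0.
Qed.
Lemma lmulDl : left_distributive lmul ladd.
Proof.
move=> f g h; rewrite !(lmulC _ h); apply: laurent_eq => n /=.
rewrite !lmul_funE -big_split /=; apply: eq_bigr => i _.
by rewrite mulrDr.
Qed.
Lemma lmul0 : left_zero lzero lmul.
Proof.
move=> f; apply: laurent_eq => n /=; apply: fsbig1 => i _.
by rewrite mul0r.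
Qed.
HB.instance Definition _ := GRing.Nmodule_isComNzSemiRing.Build laurent
  lmulA lmulC lmul1 lmulDl lmul0 lone_neq0.

Definition lscale a (f : laurent) : laurent := lmono a 0 * f.
Lemma lscaleE a f n : lscale a f n = a * f n.
Proof. by rewrite [LHS]lscale_funE subr0. Qed.

Lemma lscaleA a b v : lscale a (lscale b v) = lscale (a * b) v.
Proof. by apply: laurent_eq => n; rewrite !lscaleE mulrA. Qed.
Lemma lscale0 v : lscale 0 v = 0.
Proof. by apply: laurent_eq => n; rewrite !lscaleE mul0r. Qed.
Lemma lscale1 : left_id 1 lscale.
Proof. by move=> v; apply: laurent_eq => n; rewrite !lscaleE mul1r. Qed.
Lemma lscaleDr : right_distributive lscale +%R.
Proof. by move=> a u v; rewrite /lscale mulrDr. Qed.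
Lemma lscaleDl v : {morph lscale^~ v : a b / a + b}.
Proof. by move=> a b; apply: laurent_eq => n; rewrite lcoefD !lscaleE mulrDl. Qed.
HB.instance Definition _ := GRing.Nmodule_isLSemiModule.Build S laurent
  lscaleA lscale0 lscale1 lscaleDr lscaleDl.
Lemma lscaleAl (a : S) (u v : laurent) : a *: (u * v) = (a *: u) * v.
Proof. exact: mulrA. Qed.
HB.instance Definition _ :=
  GRing.LSemiModule_isLSemiAlgebra.Build S laurent lscaleAl.
HB.instance Definition _ :=
  GRing.LSemiAlgebra_isComSemiAlgebra.Build S laurent.

End Laurent.

Section Trop.
Variable R : realType.
Local Open Scope ereal_scope.

(* The tropical semiring: R together with -oo, sum max, product +.  So 0 is -oo
   and 1 is the real number 0. *)
Record trop := Trop { trop_val :> \bar R; trop_valP : trop_val != +oo }.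
HB.instance Definition _ := [isSub for trop_val].
HB.instance Definition _ := [Choice of trop by <:].

Lemma tadd_subproof (x y : trop) : maxe (trop_val x) (trop_val y) != +oo.
Proof. by case: x y => [[x||] hx] [[y||] hy] //=; rewrite /maxe; case: ifP. Qed.
Definition tadd x y := Trop (tadd_subproof x y).
Lemma tmul_subproof (x y : trop) : trop_val x + trop_val y != +oo.
Proof. by case: x y => [[x||] hx] [[y||] hy]. Qed.
Definition tmul x y := Trop (tmul_subproof x y).
Definition tzero := @Trop -oo isT.
Definition tone := @Trop 0 isT.
Definition tfin (a : R) : trop := @Trop a%:E isT.

Lemma taddA : associative tadd.
Proof. by move=> x y z; apply: val_inj; rewrite /= maxA. Qed.
Lemma taddC : commutative tadd.
Proof. by move=> x y; apply: val_inj; rewrite /= maxC. Qed.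
Lemma tadd0 : left_id tzero tadd.
Proof. by move=> x; apply: val_inj; rewrite /= maxNye. Qed.
HB.instance Definition _ := GRing.isNmodule.Build trop taddA taddC tadd0.
Lemma tmulA : associative tmul.
Proof. by move=> x y z; apply: val_inj; rewrite /= addeA. Qed.
Lemma tmulC : commutative tmul.
Proof. by move=> x y; apply: val_inj; rewrite /= addeC. Qed.
Lemma tmul1 : left_id tone tmul.
Proof. by move=> x; apply: val_inj; rewrite /= add0e. Qed.
Lemma tmulDl : left_distributive tmul tadd.
Proof. by move=> x y z; apply: val_inj; rewrite /= adde_maxl. Qed.
Lemma tmul0 : left_zero tzero tmul.
Proof. by move=> x; apply: val_inj. Qed.
HB.instance Definition _ := GRing.Nmodule_isComNzSemiRing.Build trop
  tmulA tmulC tmul1 tmulDl tmul0 isT.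
End Trop.

Section Curve.
Variable R : realType.

(* An undirected multigraph with edge lengths.  The choice of src and tgt is the
   direction in which the edge e is identified with [0, len e]; an infinite edge
   is directed towards its end at infinity, so its tgt is the leaf vertex. *)
Record metric_graph := MetricGraph {
  vertex : finType;
  edge : finType;
  src : edge -> vertex;
  tgt : edge -> vertex;
  len : edge -> \bar R;
  graph_nonempty : (0 < #|vertex|)%N;
  graph_connected : forall u v : vertex,
    connect (fun x y => [exists e, (src e == x) && (tgt e == y) ||
                                   (src e == y) && (tgt e == x)]) u v;
  len_gt0 : forall e, (0 < len e)%E;
  len_pinfty : forall e, len e = +oo%E -> src e != tgt e /\
    forall e', e' != e -> src e' != tgt e /\ tgt e' != tgt e }.

(* The realization of the graph: every point is either a vertex or lies in the
   interior of a unique edge. *)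
Definition edge_interior (G : metric_graph) : Type :=
  {p : edge G * R | (0 < p.2) && (p.2%:E < len p.1)%E}.

Definition curve (G : metric_graph) : Type := (vertex G + edge_interior G)%type.

HB.instance Definition _ (G : metric_graph) := Choice.on (edge_interior G).
HB.instance Definition _ (G : metric_graph) :=
  Choice.copy (curve G) (vertex G + edge_interior G)%type.

(* The identification map [0, len e] -> curve G of the edge e; it is only
   meaningful on edge_dom e.  If t = +oo, or t = len e, then (e, fine t) fails
   the test of edge_interior and the value is the vertex tgt e. *)
Definition param (G : metric_graph) (e : edge G) (t : \bar R) : curve G :=
  if (t <= 0)%E then inl (src e)
  else if insub (e, fine t) : option (edge_interior G) is Some p then inr p
  else inl (tgt e).

Definition edge_dom (G : metric_graph) (e : edge G) : set (\bar R) :=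
  [set t | (0 <= t <= len e)%E].

Section CurveTopology.
Variable G : metric_graph.

(* The quotient topology of the disjoint union of the segments [0, len e], with
   [0, +oo] carrying the topology of \bar R, i.e. the one-point compactification
   of [0, +oo[. *)
Definition curve_open : set_system (curve G) :=
  [set U | forall e : edge G,
     open (param e @^-1` U : set (subspace (edge_dom e)))].

Lemma curve_openT : curve_open setT.
Proof. by move=> e; rewrite preimage_setT; exact: openT. Qed.
Lemma curve_openI : setI_closed curve_open.
Proof. by move=> A B oA oB e; rewrite preimage_setI; exact: openI. Qed.
Lemma curve_open_bigU (I : Type) (f : I -> set (curve G)) :
  (forall i, curve_open (f i)) -> curve_open (\bigcup_i f i).
Proof.
by move=> of_ e; rewrite preimage_bigcup; apply: bigcup_open => i _; exact: of_.
Qed.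
HB.instance Definition _ :=
  isOpenTopological.Build (curve G) curve_openT curve_openI curve_open_bigU.

Definition infty_pt : set (curve G) :=
  [set x | exists2 e : edge G, len e = +oo%E & x = param e +oo%E].

Definition finite_pt : set (curve G) := ~` infty_pt.

End CurveTopology.

(* The finite part of [0, l] is covered by finitely many intervals, each with a
   label a such that P a holds on it. *)
Definition piecewise (A : eqType) (l : \bar R) (P : A -> R -> Prop) : Prop :=
  exists s : seq (interval R * A), forall t : R, 0 <= t -> (t%:E <= l)%E ->
    (exists2 p, p \in s & t \in p.1) /\
    (forall p, p \in s -> t \in p.1 -> P p.2 t).

(* (G, len) is a model of the tropical curve realized by G' when there is a
   homeomorphism between the realizations that maps each edge, piece by piece,
   with speed 1 onto pieces of edges. *)
Definition curve_isometry (G G' : metric_graph) (h : curve G -> curve G') :=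
  [/\ continuous h,
      exists2 k : curve G' -> curve G, continuous k & cancel h k /\ cancel k h
    & forall e : edge G,
        piecewise (len e) (fun (a : edge G' * bool * R) t =>
          let: (e', b, c) := a in
          exists u : R, [/\ u = (-1) ^+ b * t + c, 0 <= u, (u%:E <= len e')%E &
            h (param e t%:E) = param e' u%:E])].

Section Rays.
Variable G : metric_graph.

(* r on [0, +oo] is the identification map of an infinite edge in some model of
   the tropical curve, transported to curve G. *)
Definition ray_param (r : \bar R -> curve G) : Prop :=
  exists (G' : metric_graph) (h : curve G' -> curve G) (e : edge G'),
    [/\ curve_isometry h, len e = +oo%E & r = fun t => h (param e t)].

Definition is_ray (A : set (curve G)) : Prop :=
  exists2 r, ray_param r & A = r @` [set` `[0%E, +oo%E]].

Definition ray : Type := {A : set (curve G) | is_ray A}.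

(* The parametrization r of a ray is directed towards the point at infinity. *)
Definition slope_at_infty (f : curve G -> \bar R) (rho : ray) (m : int) :=
  forall r, ray_param r -> sval rho = r @` [set` `[0%E, +oo%E]] ->
  exists c : R, \forall t \near +oo, f (r t%:E) = (m%:~R * t + c)%:E.

Definition rational (f : curve G -> \bar R) : Prop :=
  f = cst -oo%E \/
  [/\ continuous f, forall x, finite_pt x -> f x \is a fin_num &
      forall e : edge G, piecewise (len e) (fun (a : int * R) t =>
        f (param e t%:E) = (a.1%:~R * t + a.2)%:E)].

Definition rat_add (f g : curve G -> \bar R) : curve G -> \bar R :=
  fun x => maxe (f x) (g x).

(* At points at infinity f + g may be an undefined expression oo - oo, so the
   value is the continuous extension from the finite points. *)
Definition rat_mul (f g : curve G -> \bar R) : curve G -> \bar R :=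
  fun x => if `[< finite_pt x >] then (f x + g x)%E
           else lim ((f y + g y)%E @[y --> within (@finite_pt G) (nbhs x)]).

End Rays.

Record par_curve := ParCurve {
  par_graph :> metric_graph;
  parallel : ray par_graph -> ray par_graph -> Prop;
  parallel_equiv : Equivalence parallel;
  parallel_sub : forall rho rho' : ray par_graph,
    sval rho `<=` sval rho' -> parallel rho rho' }.

Definition rational_par (G : par_curve) (f : curve G -> \bar R) : Prop :=
  rational f /\
  (f = cst -oo%E \/ forall rho rho' : ray G, parallel rho rho' ->
     exists m : int, slope_at_infty f rho m /\ slope_at_infty f rho' m).

Record rat_par (G : par_curve) := RatPar {
  rat_fun :> curve G -> \bar R;
  rat_funP : rational_par rat_fun }.

HB.instance Definition _ (G : par_curve) := gen_eqMixin (rat_par G).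
HB.instance Definition _ (G : par_curve) := gen_choiceMixin (rat_par G).

Section CurveLemmas.
Variable G : metric_graph.
Implicit Types (e : edge G) (f g : curve G -> \bar R).

Lemma param_pinfty e : param e +oo%E = inl (tgt e).
Proof. by rewrite /param /= insubF //= ltxx. Qed.

Lemma param_eq_infty e e' t : len e = +oo%E -> t \in edge_dom e' ->
  param e' t = param e +oo%E -> e' = e /\ t = +oo%E.
Proof.
move=> le; rewrite inE /edge_dom /= => /andP[t0 tl].
have [se oe] := len_pinfty le.
rewrite param_pinfty /param; case: ifP => [_ [est]|/negbT].
  have [ee'|/oe[]] := eqVneq e' e; last by rewrite est eqxx.
  by move: se; rewrite -est ee' eqxx.
rewrite -ltNge => t0'; case: insubP => //= nlt [ett].
have [ee'|/oe[]] := eqVneq e' e; last by rewrite ett eqxx.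
split=> //; subst e'; move: nlt; rewrite le.
by case: t t0' {t0 tl} => //= r; rewrite lte_fin => ->; rewrite ltry.
Qed.

Lemma infty_paramP e t : t \in edge_dom e -> infty_pt (param e t) <-> t = +oo%E.
Proof.
move=> te; split=> [[e' le']|tE]; first by move/(param_eq_infty le' te) => [].
exists e; last by rewrite tE.
by move: te; rewrite inE /edge_dom /= tE leye_eq => /andP[_ /eqP].
Qed.

Lemma finite_param e (t : R) : 0 <= t -> (t%:E <= len e)%E ->
  finite_pt (param e t%:E).
Proof.
move=> t0 tl /infty_paramP; rewrite inE /edge_dom /= lee_fin t0 tl.
by move=> /(_ isT).
Qed.

Lemma param_inj_pos e e' (u : \bar R) t : len e = +oo%E -> (0 < u)%E ->
  t \in edge_dom e' -> param e' t = param e u -> e' = e /\ t = u.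
Proof.
move=> le u0 te.
case: u u0 => [u| |//]; last by move=> _; exact: param_eq_infty.
rewrite lte_fin => u0; rewrite {2}/param lee_fin leNgt u0 /=.
case: insubP => [[[e1 u1] /= pe] _ [? ?]|]; last first.
  by rewrite /= u0 le ltry.
subst e1 u1.
move: te; rewrite inE /edge_dom /= => /andP[t0 tl].
rewrite /param; case: ifP => // /negbT; rewrite -ltNge => tp.
case: insubP => // -[[e2 t2] /= p2] _ [E1 E2] [E3 E4].
rewrite E1 in E3; rewrite E2 in E4; split=> //.
case: t tp E4 {E2 t0 tl} => [r _ /= -> //| |//] _ /= u00.
by move: u0; rewrite -u00 ltxx.
Qed.

Lemma nbhs_infty e (U : set (curve G)) : len e = +oo%E ->
  nbhs (param e +oo%E) U <->
  U (param e +oo%E) /\ \forall t \near +oo, U (param e t%:E).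
Proof.
move=> le; have dome t : (0 <= t)%E -> edge_dom e t.
  by move=> t0; rewrite /edge_dom /= t0 le leey.
split.
  move=> nU; split; first exact: nbhs_singleton nU.
  move: nU; rewrite nbhsE => -[B [oB Bx] BU].
  have /open_subspaceP[V oV VB] := oB e.
  have Vy : V +oo%E.
    by have [] : (V `&` edge_dom e) +oo%E by rewrite VB; split=> //; exact: dome.
  have [M [_ MV]] : nbhs +oo%E V by exact: open_nbhs_nbhs.
  near=> t; apply: BU.
  have [] // : (param e @^-1` B `&` edge_dom e) t%:E.
  rewrite -VB; split; last by apply: dome; rewrite lee_fin; near: t; apply: nbhs_pinfty_ge; exact: num_real.
  by apply: MV; rewrite lte_fin; near: t; apply: nbhs_pinfty_gt; exact: num_real.
move=> [Ux [M [_ MU]]]; rewrite nbhsE.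
pose m := Num.max M 0.
exists (param e @` [set u | (m%:E < u)%E]); last first.
  move=> _ [u /= mu <-]; case: u mu => [u| |//]; rewrite ?lte_fin // => mu.
  by apply: MU; rewrite (le_lt_trans _ mu) // le_max lexx.
split; last by exists +oo%E => //=; rewrite ltry.
move=> e'; rewrite -open_subspaceIT.
have m0 : (0 <= m%:E)%E by rewrite lee_fin le_max lexx orbT.
have [->|ee'] := eqVneq e' e; last first.
  apply: open_subspace_out => t [[u /= mu] ut] tdom _; move/eqP: ee'; apply.
  have [] // := @param_inj_pos e e' u t le (le_lt_trans m0 mu) _ (esym ut).
  by rewrite inE.
apply/open_subspaceP; exists [set u | (m%:E < u)%E]; first exact: open_ereal_gt_ereal.
rewrite -setIA setIid; apply/seteqP; split=> t [].
  by move=> /= mt td; split=> //; exists t.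
move=> [u /= mu ut] td; split=> //=.
have [] // := @param_inj_pos e e u t le (le_lt_trans m0 mu) _ (esym ut).
  by rewrite inE.
by move=> _ ->.
Unshelve. all: by end_near. Qed.

Lemma open_finite_pt : open (@finite_pt G).
Proof.
move=> e; apply/open_subspaceP; exists [set u | (u < +oo)%E].
  exact: open_ereal_lt_ereal.
apply/seteqP; split=> t [] /= h td; split=> //.
  by move/infty_paramP; rewrite inE => /(_ td) tE; rewrite tE ltxx in h.
rewrite ltey; apply/eqP => tE; apply: h; apply/infty_paramP => //.
by rewrite inE.
Qed.

Lemma cvg_infty e f : len e = +oo%E -> continuous f ->
  f (param e t%:E) @[t --> +oo] --> f (param e +oo%E).
Proof.
move=> le cf W /cf /=; rewrite nbhs_filterE => /(nbhs_infty _ le)[_].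
exact.
Qed.

Lemma cvg_finite_infty e f L : len e = +oo%E ->
  f (param e t%:E) @[t --> +oo] --> L ->
  lim (f y @[y --> within (@finite_pt G) (nbhs (param e +oo%E))]) = L.
Proof.
move=> le fL.
have inf : infty_pt (param e +oo%E) by exists e.
have PF : ProperFilter (within (@finite_pt G) (nbhs (param e +oo%E))).
  split; last exact: within_filter.
  move=> /(nbhs_infty _ le)[_ H].
  near (+oo : set_system R) => t.
  have : ~ finite_pt (param e t%:E) by near: t; exact: H.
  apply; apply: finite_param; last by rewrite le leey.
  by near: t; apply: nbhs_pinfty_ge; exact: num_real.
apply: cvg_lim; first exact: ereal_hausdorff.
move=> W /fL WL; apply/(nbhs_infty _ le); split=> //.
by near=> t => _; near: t; exact: WL.
Unshelve. all: by end_near. Qed.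

Lemma rat_mul_finite f g x : finite_pt x -> rat_mul f g x = (f x + g x)%E.
Proof. by rewrite /rat_mul; case: asboolP. Qed.

Lemma rat_mul_infty e f g L : len e = +oo%E ->
  (f (param e t%:E) + g (param e t%:E))%E @[t --> +oo] --> L ->
  rat_mul f g (param e +oo%E) = L.
Proof.
move=> le fgL; rewrite /rat_mul; case: asboolP => [[]|_].
  by exists e.
exact: (@cvg_finite_infty e (fun y => f y + g y)%E).
Qed.

Lemma curve_ind (P : curve G -> Prop) :
  (forall x, finite_pt x -> P x) ->
  (forall e, len e = +oo%E -> P (param e +oo%E)) -> forall x, P x.
Proof.
move=> Pf Pi x; have [fx|/contrapT[e le ->]] := pselect (finite_pt x).
  exact: Pf.
exact: Pi.
Qed.

Lemma rat_mulNy g : (forall x, finite_pt x -> g x != +oo%E) ->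
  rat_mul (cst -oo%E) g = cst -oo%E.
Proof.
move=> gy; apply/funext; apply: curve_ind => [x fx|e le].
  by rewrite rat_mul_finite //= addNye.
apply: rat_mul_infty => //.
by under eq_fun do rewrite /= addNye; exact: cvg_cst.
Qed.

Lemma rat_mulC f g : rat_mul f g = rat_mul g f.
Proof.
by apply/funext => x; rewrite /rat_mul (eq_fun (fun y => addeC (f y) (g y))) addeC.
Qed.

Lemma rational_finite f x : rational f -> finite_pt x -> f x != +oo%E.
Proof.
move=> [->//|[_ ff _]] /ff; by case: (f x).
Qed.

Lemma rational_continuous f : rational f -> continuous f.
Proof. by move=> [->|[]//]; exact: cst_continuous. Qed.

Lemma rational_ext f g : rational f -> rational g ->
  (forall x, finite_pt x -> f x = g x) -> f = g.
Proof.
move=> rf rg fg; apply/funext; apply: curve_ind => // e le.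
have cf := cvg_infty le (rational_continuous rf).
have cg := cvg_infty le (rational_continuous rg).
apply: (cvg_unique _ cf); first exact: ereal_hausdorff.
apply: cvg_trans cg; apply: near_eq_cvg; near=> t; apply/esym/fg.
apply: finite_param; last by rewrite le leey.
by near: t; apply: nbhs_pinfty_ge; exact: num_real.
Unshelve. all: by end_near. Qed.

Lemma itv_tail (i : interval R) : (exists M, forall t, t \in i -> t <= M) \/
  (forall t u, t \in i -> t <= u -> u \in i).
Proof.
case: i => l [b x|[]].
- left; exists x => t; rewrite itv_boundlr => /andP[_].
  by case: b; rewrite bnd_simp //; exact: ltW.
- by left; exists 0 => t; rewrite itv_boundlr => /andP[_].
right=> t u; rewrite !itv_boundlr => /andP[lt _] tu; apply/andP; split=> //.
by apply: (le_trans lt); rewrite bnd_simp.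
Qed.

Lemma piecewise_tail (A : eqType) (P : A -> R -> Prop) :
  piecewise +oo%E P -> exists a, \forall t \near +oo, P a t.
Proof.
move=> [s sP].
have [M MP] : exists M, forall p, p \in s -> (forall t, t \in p.1 -> t <= M) \/
    (forall t u, t \in p.1 -> t <= u -> u \in p.1).
  elim: s {sP} => [|p s [M MP]]; first by exists 0.
  have [[N NP]|pP] := itv_tail p.1.
    exists (Num.max N M) => q; rewrite inE => /predU1P[->|/MP[qP|qP]].
    - by left=> t /NP tN; rewrite le_max tN.
    - by left=> t /qP tN; rewrite le_max tN orbT.
    - by right.
  by exists M => q; rewrite inE => /predU1P[->|/MP//]; right.
have t0 : 0 <= Num.max M 0 + 1 by rewrite addr_ge0 // le_max lexx orbT.
have [[p ps tp] _] := sP _ t0 (leey _).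
exists p.2; near=> t; have [] := MP _ ps.
  move=> /(_ _ tp); rewrite leNgt => /negP[].
  by rewrite (@le_lt_trans _ _ (Num.max M 0)) ?ltrDl // le_max lexx.
move=> /(_ _ t tp) tt; have t0' : 0 <= t.
  by near: t; apply: nbhs_pinfty_ge; exact: num_real.
apply: (sP t t0' (leey _)).2 => //.
by apply: tt; near: t; apply: nbhs_pinfty_ge; exact: num_real.
Unshelve. all: by end_near. Qed.


Lemma piecewise_bind (A B C : eqType) l (P : A -> R -> Prop) (Q : B -> R -> Prop)
    (S : C -> R -> Prop) :
  (forall a b, exists s : seq (interval R * C), forall t,
    (exists2 p, p \in s & t \in p.1) /\
    (forall p, p \in s -> t \in p.1 -> P a t -> Q b t -> S p.2 t)) ->
  piecewise l P -> piecewise l Q -> piecewise l S.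
Proof.
move=> H [s1 s1P] [s2 s2P].
have {}/choice[F FP] : forall ab : A * B, exists s : seq (interval R * C),
    forall t, (exists2 p, p \in s & t \in p.1) /\
    (forall p, p \in s -> t \in p.1 -> P ab.1 t -> Q ab.2 t -> S p.2 t).
  by move=> [a b]; exact: H.
exists [seq ((pq.1.1 `&` pq.2.1 `&` r.1)%O, r.2) |
   pq <- [seq (p, q) | p <- s1, q <- s2], r <- F (pq.1.2, pq.2.2)] => t t0 tl.
have [[p ps pt] pP] := s1P t t0 tl.
have [[q qs qt] qP] := s2P t t0 tl.
split.
  have [[r rs rt] _] := FP (p.2, q.2) t.
  exists ((p.1 `&` q.1 `&` r.1)%O, r.2); last by rewrite !in_itvI pt qt.
  apply/allpairsPdep; exists (p, q), r; split=> //.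
  by apply/allpairsPdep; exists p, q.
move=> _ /allpairsPdep[_ [r [/allpairsPdep[p' [q' [ps' qs' ->]]] rs ->]]] /=.
rewrite !in_itvI => /andP[/andP[pt' qt'] rt].
have [_ /(_ _ rs rt)] := FP (p'.2, q'.2) t.
by apply; [exact: pP|exact: qP].
Qed.

Lemma halfline (k b : R) : exists i : interval R, forall t,
  (t \in i) = (0 <= k * t + b).
Proof.
have [k0|k0|<-] := ltgtP 0 k.
- exists `[(- b / k), +oo[ => t; rewrite in_itv /= andbT ler_pdivrMr // mulrC.
  by rewrite -subr_ge0 opprK.
- exists `]-oo, (- b / k)] => t; rewrite in_itv /= ler_ndivlMr // mulrC.
  by rewrite -subr_ge0 opprK.
have [b0|b0] := leP 0 b.
  by exists `]-oo, +oo[ => t; rewrite in_itv /= mul0r add0r b0.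
by exists `]0, 0[ => t; rewrite itv_ge ?bnd_simp ?ltxx // mul0r add0r leNgt b0.
Qed.

Lemma rational_cst (a : \bar R) : a != +oo%E -> rational (cst a : curve G -> \bar R).
Proof.
case: a => [r _| //|_]; last by left.
right; split=> //; first exact: cst_continuous.
move=> e; exists [:: (`]-oo, +oo[, (0, r))] => t t0 tl; split.
  by exists (`]-oo, +oo[, (0, r)); rewrite ?mem_head // in_itv.
by move=> p; rewrite mem_seq1 => /eqP -> _ /=; rewrite mul0r add0r.
Qed.

Lemma rat_addC f g : rat_add f g = rat_add g f.
Proof. by apply/funext => x; rewrite /rat_add maxC. Qed.

Lemma rat_addNy g : rat_add (cst -oo%E) g = g.
Proof. by apply/funext => x; rewrite /rat_add maxNye. Qed.

Lemma rational_add f g : rational f -> rational g -> rational (rat_add f g).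
Proof.
move=> [->|[cf ff pf]]; first by rewrite rat_addNy.
move=> [->|[cg fg pg]]; first by rewrite rat_addC rat_addNy; right.
right; split.
- exact: (max_fun_continuous cf cg).
- by move=> x fx; rewrite /rat_add /maxe; case: ifP => _; [exact: fg|exact: ff].
move=> e; apply: piecewise_bind (pf e) (pg e) => -[m c] [m' c'].
have [i1 i1P] := halfline (m%:~R - m'%:~R) (c - c').
have [i2 i2P] := halfline (m'%:~R - m%:~R) (c' - c).
have dE (a b a' b' t : R) : (a - a') * t + (b - b') = (a * t + b) - (a' * t + b').
  by rewrite mulrBl addrACA opprD.
exists [:: (i1, (m, c)); (i2, (m', c'))] => t.
have i1E : t \in i1 = (m'%:~R * t + c' <= m%:~R * t + c).
  by rewrite i1P dE subr_ge0.
have i2E : t \in i2 = (m%:~R * t + c <= m'%:~R * t + c').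
  by rewrite i2P dE subr_ge0.
split.
  have [h|h] := leP (m'%:~R * t + c') (m%:~R * t + c).
    by exists (i1, (m, c)); [exact: mem_head|rewrite /= i1E].
  by exists (i2, (m', c')); [rewrite in_cons mem_head orbT|rewrite /= i2E ltW].
move=> p; rewrite in_cons mem_seq1 => /orP[]/eqP -> /=; rewrite ?i1E ?i2E => h ft gt.
  by rewrite /rat_add ft gt -EFin_max max_l.
by rewrite /rat_add ft gt -EFin_max max_r.
Qed.

Lemma affine_cvg (m : int) (c : R) :
  exists L : \bar R, (m%:~R * t + c)%:E @[t --> +oo] --> L.
Proof.
have [m0|m0|<-] := ltgtP 0 m.
- exists +oo%E; apply/cvgeryP; apply/cvgryPge => A.
  have mp : 0 < (m%:~R : R) by rewrite ltr0z.
  near=> t; rewrite -lerBlDr -ler_pdivrMl //.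
  by near: t; apply: nbhs_pinfty_ge; exact: num_real.
- exists -oo%E; apply/cvgerNyP; apply/cvgrNyPle => A.
  have mp : (m%:~R : R) < 0 by rewrite ltrz0.
  near=> t; rewrite -lerBrDr -ler_ndivrMl //.
  by near: t; apply: nbhs_pinfty_ge; exact: num_real.
exists c%:E; under eq_fun do rewrite mul0r add0r; exact: cvg_cst.
Unshelve. all: by end_near. Qed.

Lemma rat_mul_continuous f g :
  continuous f -> (forall x, finite_pt x -> f x \is a fin_num) ->
  continuous g -> (forall x, finite_pt x -> g x \is a fin_num) ->
  (forall e, len e = +oo%E ->
    exists L : \bar R,
      (f (param e t%:E) + g (param e t%:E))%E @[t --> +oo] --> L) ->
  continuous (rat_mul f g).
Proof.
move=> cf ff cg fg H; apply: curve_ind => [x fx|e le].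
  have nfx : nbhs x (@finite_pt G).
    by apply: open_nbhs_nbhs; split=> //; exact: open_finite_pt.
  rewrite /continuous_at rat_mul_finite //.
  have d : (f x +? g x)%E by apply: fin_num_adde_defl; exact: fg.
  have fgx : (f y + g y)%E @[y --> x] --> (f x + g x)%E.
    exact: (@cvgeD _ (nbhs x) _ R f g (f x) (g x) d (cf x) (cg x)).
  apply: cvg_trans fgx; apply: (@near_eq_cvg _ _ (nbhs x)).
  near=> y; rewrite rat_mul_finite //.
  by near: y.
have [L fgL] := H e le.
have E := rat_mul_infty le fgL.
rewrite /continuous_at => W; rewrite E => WL; apply/(nbhs_infty _ le).
split; first by rewrite /= E; exact: nbhs_singleton WL.
near=> t; rewrite /= rat_mul_finite; first by near: t; exact: fgL.
apply: finite_param; last by rewrite le leey.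
by near: t; apply: nbhs_pinfty_ge; exact: num_real.
Unshelve. all: by end_near. Qed.

Lemma rational_mul f g : rational f -> rational g -> rational (rat_mul f g).
Proof.
move=> rf rg; have gy x := @rational_finite g x rg.
have fy x := @rational_finite f x rf.
case: rf rg => [->|[cf ff pf]]; first by rewrite rat_mulNy //; left.
move=> [->|[cg fg pg]]; first by rewrite rat_mulC rat_mulNy //; left.
have pm e : piecewise (len e) (fun (a : int * R) t =>
    (f (param e t%:E) + g (param e t%:E))%E = (a.1%:~R * t + a.2)%:E).
  apply: piecewise_bind (pf e) (pg e) => -[m c] [m' c'].
  exists [:: (`]-oo, +oo[, (m + m', c + c'))] => t; split.
    by exists (`]-oo, +oo[, (m + m', c + c')); rewrite ?mem_head // in_itv.
  move=> p; rewrite mem_seq1 => /eqP -> _ /= -> ->.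
  by rewrite -EFinD rmorphD /= mulrDl addrACA.
right; split.
- apply: rat_mul_continuous => // e le.
  have := pm e; rewrite le => /piecewise_tail[[m c] /= mcP].
  have [L mcL] := affine_cvg m c; exists L.
  apply: cvg_trans mcL; apply: near_eq_cvg.
  by apply: filterS mcP => t ->.
- by move=> x fx; rewrite rat_mul_finite // fin_numD ff ?fg.
move=> e; have [s sP] := pm e; exists s => t t0 tl.
have [? sP2] := sP t t0 tl; split=> // p ps pt.
by rewrite rat_mul_finite; [exact: sP2|exact: finite_param].
Qed.

Lemma ray_param_finite (r : \bar R -> curve G) (t : R) :
  ray_param r -> 0 <= t -> finite_pt (r t%:E).
Proof.
move=> [G' [h [e [[_ _ hp] le ->]]]] t0.
have [s /(_ t t0)] := hp e; rewrite le => /(_ (leey _))[[p ps pt]].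
move=> /(_ p ps pt); case: p.2 => [[e' b] c] [u [_ u0 ul ->]].
exact: finite_param.
Qed.

Lemma slope_cst (a : R) (rho : ray G) : slope_at_infty (cst a%:E) rho 0.
Proof. by move=> r _ _; exists a; near=> t; rewrite mul0r add0r.
Unshelve. all: by end_near. Qed.

Lemma slope_mul f g (rho : ray G) m m' :
  slope_at_infty f rho m -> slope_at_infty g rho m' ->
  slope_at_infty (rat_mul f g) rho (m + m').
Proof.
move=> fm gm r rp rho_r.
have [c cP] := fm r rp rho_r; have [c' c'P] := gm r rp rho_r.
exists (c + c'); near=> t; rewrite rat_mul_finite; last first.
  apply: ray_param_finite rp _.
  by near: t; apply: nbhs_pinfty_ge; exact: num_real.
rewrite (near cP t) // (near c'P t) //.
by rewrite -EFinD rmorphD /= mulrDl addrACA.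
Unshelve. all: by end_near. Qed.

Lemma slope_add f g (rho : ray G) m m' :
  slope_at_infty f rho m -> slope_at_infty g rho m' ->
  slope_at_infty (rat_add f g) rho (Num.max m m').
Proof.
wlog mm' : f g m m' / m <= m'.
  move=> W fm gm; have [h|/ltW h] := leP m m'.
    by have := W _ _ _ _ h fm gm; rewrite max_r.
  by have := W _ _ _ _ h gm fm; rewrite rat_addC max_r.
move=> fm gm r rp rho_r; rewrite max_r //.
have [c cP] := fm r rp rho_r; have [c' c'P] := gm r rp rho_r.
move: mm'; rewrite le_eqVlt => /predU1P[mm'|mm'].
  subst m'; exists (Num.max c c'); near=> t.
  rewrite /rat_add (near cP t) // (near c'P t) // -EFin_max.
  by rewrite addr_maxr.
exists c'; near=> t.
rewrite /rat_add (near cP t) // (near c'P t) // -EFin_max max_r //.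
rewrite -subr_ge0 opprD addrACA -mulrBl -lerBlDr sub0r.
have d0 : 0 < (m'%:~R - m%:~R : R) by rewrite subr_gt0 ltr_int.
rewrite -ler_pdivrMl //.
by near: t; apply: nbhs_pinfty_ge; exact: num_real.
Unshelve. all: by end_near. Qed.

End CurveLemmas.

Section RatParAlgebra.
Variable G : par_curve.
Implicit Types (f g : curve G -> \bar R) (u v w : rat_par G).

Lemma rational_par_cst (a : \bar R) : a != +oo%E ->
  rational_par (cst a : curve G -> \bar R).
Proof.
move=> ay; split; first exact: rational_cst.
case: a ay => [r _| //|_]; last by left.
by right=> rho rho' _; exists 0; split; exact: slope_cst.
Qed.

Lemma rational_par_add f g :
  rational_par f -> rational_par g -> rational_par (rat_add f g).
Proof.
move=> [rf sf] [rg sg]; split; first exact: rational_add.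
case: sf => [->|sf]; first by rewrite rat_addNy.
case: sg => [->|sg]; first by rewrite rat_addC rat_addNy; right.
right=> rho rho' par.
have [m [m1 m2]] := sf _ _ par; have [m' [m1' m2']] := sg _ _ par.
by exists (Num.max m m'); split; exact: slope_add.
Qed.

Lemma rational_par_mul f g :
  rational_par f -> rational_par g -> rational_par (rat_mul f g).
Proof.
move=> [rf sf] [rg sg]; split; first exact: rational_mul.
case: sf => [->|sf].
  by left; rewrite rat_mulNy // => x; exact: rational_finite.
case: sg => [->|sg].
  by left; rewrite rat_mulC rat_mulNy // => x; exact: rational_finite.
right=> rho rho' par.
have [m [m1 m2]] := sf _ _ par; have [m' [m1' m2']] := sg _ _ par.
by exists (m + m'); split; exact: slope_mul.
Qed.

Definition rpadd u v := RatPar (rational_par_add (rat_funP u) (rat_funP v)).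
Definition rpmul u v := RatPar (rational_par_mul (rat_funP u) (rat_funP v)).
Definition rpcst (a : trop R) := RatPar (rational_par_cst (trop_valP a)).

Lemma rat_par_eq u v : (forall x, finite_pt x -> u x = v x) -> u = v.
Proof.
case: u v => f [rf sf] [g [rg sg]] /= /(rational_ext rf rg) fg.
by subst g; congr RatPar; exact: Prop_irrelevance.
Qed.

Lemma rpaddE u v x : rpadd u v x = maxe (u x) (v x). Proof. by []. Qed.
Lemma rpmulE u v x : finite_pt x -> rpmul u v x = (u x + v x)%E.
Proof. by move=> fx; rewrite [LHS]rat_mul_finite. Qed.
Lemma rpcstE a x : rpcst a x = trop_val a. Proof. by []. Qed.

Lemma rpaddA : associative rpadd.
Proof. by move=> u v w; apply: rat_par_eq => x _; rewrite !rpaddE maxA. Qed.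
Lemma rpaddC : commutative rpadd.
Proof. by move=> u v; apply: rat_par_eq => x _; rewrite !rpaddE maxC. Qed.
Lemma rpadd0 : left_id (rpcst 0) rpadd.
Proof. by move=> u; apply: rat_par_eq => x _; rewrite !rpaddE rpcstE maxNye. Qed.
HB.instance Definition _ :=
  GRing.isNmodule.Build (rat_par G) rpaddA rpaddC rpadd0.

Lemma rpmulA : associative rpmul.
Proof. by move=> u v w; apply: rat_par_eq => x fx; rewrite !rpmulE // addeA. Qed.
Lemma rpmulC : commutative rpmul.
Proof. by move=> u v; apply: rat_par_eq => x fx; rewrite !rpmulE // addeC. Qed.
Lemma rpmul1 : left_id (rpcst 1) rpmul.
Proof.
by move=> u; apply: rat_par_eq => x fx; rewrite !rpmulE // rpcstE add0e.
Qed.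
Lemma rpmulDl : left_distributive rpmul rpadd.
Proof.
move=> u v w; apply: rat_par_eq => x fx.
by rewrite !(rpmulE, rpaddE) // adde_maxl.
Qed.
Lemma rpmul0 : left_zero (rpcst 0) rpmul.
Proof.
by move=> u; apply: rat_par_eq => x fx; rewrite !rpmulE // rpcstE addNye.
Qed.
Lemma rpone_neq0 : rpcst 1 != rpcst 0.
Proof.
have /card_gt0P[v _] := graph_nonempty G.
by apply/eqP => /(congr1 (fun u : rat_par G => u (inl v))).
Qed.
HB.instance Definition _ := GRing.Nmodule_isComNzSemiRing.Build (rat_par G)
  rpmulA rpmulC rpmul1 rpmulDl rpmul0 rpone_neq0.

Definition rpscale (a : trop R) u := rpcst a * u.

Lemma rpcstM a b : rpcst (a * b) = rpcst a * rpcst b.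
Proof. by apply: rat_par_eq => x fx; rewrite [RHS]rpmulE. Qed.
Lemma rpcstD a b : rpcst (a + b) = rpcst a + rpcst b.
Proof. by apply: rat_par_eq => x fx. Qed.

Lemma rpscaleA a b u : rpscale a (rpscale b u) = rpscale (a * b) u.
Proof. by rewrite /rpscale rpcstM mulrA. Qed.
Lemma rpscale0 u : rpscale 0 u = 0.
Proof. exact: mul0r. Qed.
Lemma rpscale1 : left_id 1 rpscale.
Proof. exact: mul1r. Qed.
Lemma rpscaleDr : right_distributive rpscale +%R.
Proof. by move=> a u v; rewrite /rpscale mulrDr. Qed.
Lemma rpscaleDl u : {morph rpscale^~ u : a b / a + b}.
Proof. by move=> a b; rewrite /rpscale rpcstD mulrDl. Qed.
HB.instance Definition _ := GRing.Nmodule_isLSemiModule.Build (trop R)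
  (rat_par G) rpscaleA rpscale0 rpscale1 rpscaleDr rpscaleDl.
Lemma rpscaleAl (a : trop R) u v : a *: (u * v) = (a *: u) * v.
Proof. exact: mulrA. Qed.
HB.instance Definition _ :=
  GRing.LSemiModule_isLSemiAlgebra.Build (trop R) (rat_par G) rpscaleAl.
HB.instance Definition _ :=
  GRing.LSemiAlgebra_isComSemiAlgebra.Build (trop R) (rat_par G).

(* At a finite point, the values u x lie in the tropical semiring, seen inside
   \bar R. *)
Definition phi (x : curve G) : set (rat_par G * rat_par G) :=
  if `[< finite_pt x >] then Ker (fun u : rat_par G => u x)
  else [set p : rat_par G * rat_par G | \forall y \near x, p.1 y = p.2 y].

End RatParAlgebra.
End Curve.

Section Types.
Variables (R : realType) (K : comSemiAlgType (trop R)).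

Definition Ymono (a : R) (m : int) : laurent (trop R) := lmono (tfin a) m.

(* P(Z(1)) *)
Definition PZ1 : congruence (laurent (trop R)) :=
  congr_gen [set p | exists (a1 a2 : R) (m1 m2 : int),
    m2 <= m1 /\ p = (Ymono a1 m1 + Ymono a2 m2, Ymono a1 m1)].

(* P(U(1,0;2)) *)
Definition PU2 : congruence (laurent (trop R)) :=
  congr_gen [set p | exists (a1 a2 : R) (m1 m2 : int),
    (m2 < m1 \/ (m1 = m2 /\ a2 <= a1)) /\
    p = (Ymono a1 m1 + Ymono a2 m2, Ymono a1 m1)].

Definition type_I1 (P : congruence K) : Prop :=
  prime_congruence P /\ quot P \isoalg quot PZ1.

Definition type_I2 (P : congruence K) : Prop :=
  prime_congruence P /\ quot P \isoalg quot PU2.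

End Types.

(* Main.v *)
From HB Require Import structures.
From mathcomp Require Import all_boot all_order all_algebra.
From mathcomp Require Import finmap.
From mathcomp Require Import all_classical all_reals ereal topology normedtype.
From mathcomp Require Import lra.
Require Import Defs.

Set Implicit Arguments.
Unset Strict Implicit.
Unset Printing Implicit Defensive.
Import Order.TTheory GRing.Theory Num.Theory.
Import numFieldNormedType.Exports.
Local Open Scope classical_set_scope.
Local Open Scope ring_scope.

(** Write K for the semifield of rational functions. In this explanation
    functions are added as functions, so that their sum is the product of K,
    and 0 is the zero function, the unit of K. For a prime congruence P the
    quotient K/P is totally ordered by u <= v :<-> max(u, v) = v, and pointwise
    inequalities of functions survive in it.

    Primes of type I-2 are germs at points at infinity ([type_I2_phi]). The
    model T[Y]/P(U(1,0;2)) keeps the leading monomial of a Laurent polynomial,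
    so modulo P the constants are pairwise distinct and some class lies above
    all of them. Every function is at most n + n * dist for some n, where dist
    measures the distance along all infinite edges ([rational_bound]); hence
    dist lies above all constants modulo P. Therefore dist cut at the height 1
    is congruent to the constant 1. As it is the maximum of its pieces on the
    single infinite edges, there is an edge e whose piece is not congruent to
    0. Two nonnegative functions with disjoint supports satisfy u + v = max(u,
    v), and the maximum is congruent to u or to v, so one of the two functions
    is congruent to 0. It follows that the piece of height a >= 1 on e is
    congruent to a, and that the distance along the rays that are not parallel
    to e is congruent to 0. If h is nonpositive near the end x of e, then the
    sum of h and the piece of some large height N on e is at most N plus a
    multiple of the latter distance, and this gives h <= 0 modulo P
    ([quot_le1_near]). Thus P contains the congruence of germs at x; and it is
    equal to it, because two different germs at x differ by at least a positive
    constant near x.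

    If the germs at the ends of e and e' both lie in a prime I of type I-1,
    whose quotient identifies all constants, suppose that e and e' are not
    parallel. Then the distance D along the rays parallel to e is a function of
    K, and it vanishes near the end of e'; so it is congruent to 0 modulo I.
    Near the end of e every function is at most a constant plus a multiple of
    D, so all of K/I is at most 0, whereas T[Y]/P(Z(1)) has larger elements
    ([common_I1_parallel]).

    Conversely, for parallel e and e', the slope at infinity is the same along
    e and e' and depends only on the germ. The kernel of the slope map is
    prime, and its quotient is the quotient of the Laurent polynomials by the
    kernel of the degree map, which is P(Z(1)) ([slope_type_I1]).

    Rays come from arbitrary models of the curve. A piecewise speed-one
    parametrization agrees with a shifted infinite edge near its end, and this
    agreement extends backwards until one of the two segments stops
    ([agree_max]); so a ray and the edge with the same end are comparable by
    inclusion, hence parallel. This reduces parallelism of rays to an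
    equivalence relation on the infinite edges. *)

(** * The natural order of an idempotent semiring *)

(** For the tropical addition this is the usual order, and on functions the
    pointwise one. *)
Definition nle (S : comPzSemiRingType) (u v : S) := u + v = v.

Section NaturalOrder.
Variable S : comPzSemiRingType.
Hypothesis addxx : forall u : S, u + u = u.
Implicit Types u v w : S.

Lemma nle_refl u : nle u u. Proof. exact: addxx. Qed.

Lemma nle_trans v u w : nle u v -> nle v w -> nle u w.
Proof. by move=> uv vw; rewrite /nle -vw addrA uv. Qed.

Lemma nle_anti u v : nle u v -> nle v u -> u = v.
Proof. by move=> uv vu; rewrite -vu addrC. Qed.

Lemma nleMr w u v : nle u v -> nle (u * w) (v * w).
Proof. by move=> uv; rewrite /nle -mulrDl uv. Qed.

Lemma nleM u v u' v' : nle u v -> nle u' v' -> nle (u * u') (v * v').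
Proof.
move=> uv uv'; apply: (nle_trans (nleMr u' uv)).
by rewrite ![v * _]mulrC; exact: nleMr.
Qed.

Lemma nleX u v n : nle u v -> nle (u ^+ n) (v ^+ n).
Proof.
move=> uv; elim: n => [|n IH]; first by rewrite !expr0; exact: nle_refl.
by rewrite !exprS; exact: nleM.
Qed.

Lemma nle_addl u v : nle u (u + v).
Proof. by rewrite /nle addrA addxx. Qed.

End NaturalOrder.

(** * Quotients by prime congruences *)

Section PrimeQuotient.
Variables (R : pzSemiRingType) (S : comSemiAlgType R) (P : congruence S).
Hypothesis addxx : forall u : S, u + u = u.
Hypothesis primeP : prime_congruence P.
Implicit Types u v w : quot P.

Lemma qpiM (x y : S) : qpi P (x * y) = qpi P x * qpi P y.
Proof. by rewrite [RHS]qmulE. Qed.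

Lemma qpiX (x : S) n : qpi P (x ^+ n) = qpi P x ^+ n.
Proof. by elim: n => [|n IH]; rewrite ?expr0 // !exprS qpiM IH. Qed.

Lemma qpiZ a (x : S) : qpi P (a *: x) = a *: qpi P x.
Proof. by rewrite [RHS]qscaleE. Qed.

Lemma qpi_sum (I : Type) (s : seq I) (C : pred I) (F : I -> S) :
  qpi P (\sum_(i <- s | C i) F i) = \sum_(i <- s | C i) qpi P (F i).
Proof. exact: (big_morph (qpi P) (@qpiD _ _ P)). Qed.

Lemma quot_addxx u : u + u = u.
Proof. by elim/qpi_ind: u => x; rewrite -qpiD addxx. Qed.

(** Expanding the twisted product of (x + y, y) and (x + y, x) gives two equal
    elements, by idempotence; so primality puts one of the two pairs in P. *)
Lemma quot_total u v : nle u v \/ nle v u.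
Proof.
elim/qpi_ind: u => x; elim/qpi_ind: v => y; rewrite /nle -!qpiD.
have /primeP.2[/qpiP xy|/qpiP xy] : congr_set P
    ((x + y) * (x + y) + y * x, (x + y) * x + y * (x + y)).
- apply/qpiP; congr qpi; rewrite !(mulrDl, mulrDr) (mulrC y x).
  by rewrite [x * y + y * y]addrC -!addrA addxx.
- by left.
- by right; rewrite addrC.
Qed.

Lemma quot_mulIr w u v : w != 0 -> u * w = v * w -> u = v.
Proof.
elim/qpi_ind: u => x; elim/qpi_ind: v => y; elim/qpi_ind: w => z z0.
rewrite -!qpiM => /qpiP h.
have /primeP.2[/qpiP //|/qpiP h'] : congr_set P (x * z + y * 0, x * 0 + y * z).
  by rewrite !mulr0 addr0 add0r.
by rewrite h' eqxx in z0.
Qed.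

Lemma quot_one_neq0 : (1 : quot P) != 0.
Proof.
apply/eqP => h; apply: primeP.1; apply/seteqP; split=> // -[x y] _.
apply/qpiP; rewrite -[x]mulr1 -[y]mulr1 !qpiM.
by rewrite [qpi P 1]h !mulr0.
Qed.

End PrimeQuotient.

(** * Congruences defined by morphisms *)

Section KernelCongruence.
Variables (A S : comPzSemiRingType) (T : Type) (F : set_system T).
Context {FF : Filter F}.
Variable alpha : T -> {rmorphism A -> S}.

(** A filter of morphisms replaces the limit morphism, which in the application
    (evaluation at arbitrarily large points) does not exist in the target
    semiring. *)
Program Definition near_congruence : congruence A :=
  @Congruence A [set p | \forall t \near F, alpha t p.1 = alpha t p.2]
    _ _ _ _ _.
Next Obligation. by move=> x /=; near=> t. Unshelve. all: by end_near. Qed.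
Next Obligation. by move=> x y /=; apply: filterS. Qed.
Next Obligation. by move=> y x z /=; apply: filterS2 => t -> ->. Qed.
Next Obligation.
by move=> x y x' y' /=; apply: filterS2 => t; rewrite !rmorphD => -> ->.
Qed.
Next Obligation.
by move=> x y x' y' /=; apply: filterS2 => t; rewrite !rmorphM => -> ->.
Qed.

End KernelCongruence.

Section Kernel.
Variables (A S : comPzSemiRingType) (alpha : {rmorphism A -> S}).

Program Definition ker_congruence : congruence A :=
  @Congruence A (Ker alpha) _ _ _ _ _.
Next Obligation. by move=> x. Qed.
Next Obligation. by move=> x y. Qed.
Next Obligation. by move=> y x z; rewrite /Ker /= => -> ->. Qed.
Next Obligation. by move=> x y x' y'; rewrite /Ker /= !rmorphD => -> ->. Qed.
Next Obligation. by move=> x y x' y'; rewrite /Ker /= !rmorphM => -> ->. Qed.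

End Kernel.

(** * Evaluation of Laurent polynomials *)

Section LaurentEval.
Variables (S S' : comNzSemiRingType) (sigma : {rmorphism S -> S'}).
Variable y : int -> S'.
Hypothesis y0 : y 0 = 1.
Hypothesis yD : forall m n, y (m + n) = y m * y n.
Implicit Types f g : laurent S.

(** The coefficients are mapped by sigma and the exponents by y, a morphism
    from the group of integers to the multiplicative monoid of the target. *)
Definition leval f : S' := \sum_(n \in [set: int]) sigma (f n) * y n.

Lemma levalE (A : {fset int}) f : (forall n, n \notin A -> f n = 0) ->
  leval f = \sum_(n <- A) sigma (f n) * y n.
Proof. by move=> fA; apply: fsbigTE => n /fA ->; rewrite rmorph0 mul0r. Qed.

Lemma leval_mono a m : leval (lmono a m) = sigma a * y m.
Proof.
rewrite (levalE (A := [fset m]%fset)).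
  by rewrite big_seq_fset1 /= /lmono_fun eqxx.
by move=> n; rewrite inE /= /lmono_fun => /negbTE ->.
Qed.

Lemma leval0 : leval 0 = 0.
Proof.
by apply: fsbig1 => n _; rewrite rmorph0 mul0r.
Qed.

Lemma levalD f g : leval (f + g) = leval f + leval g.
Proof.
have fA n : n \notin (lsupp f `|` lsupp g)%fset -> f n = 0.
  by rewrite inE negb_or => /andP[/lsuppP].
have gA n : n \notin (lsupp f `|` lsupp g)%fset -> g n = 0.
  by rewrite inE negb_or => /andP[_ /lsuppP].
rewrite (levalE fA) (levalE gA) (levalE (A := (lsupp f `|` lsupp g)%fset)).
  by rewrite -big_split; apply: eq_bigr => n _; rewrite lcoefD rmorphD mulrDl.
by move=> n nA; rewrite lcoefD fA // gA // addr0.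
Qed.

Lemma levalM f g : leval (f * g) = leval f * leval g.
Proof.
pose A := [fset (i + j)%R | i in lsupp f, j in lsupp g]%fset.
have gA i n : i \in lsupp f -> n \notin A -> g (n - i) = 0.
  move=> fi nA; apply: lsuppP; apply: contraNN nA => gi.
  by apply/imfset2P; exists i => //; exists (n - i) => //; rewrite addrC subrK.
have fgE n : (f * g) n = \sum_(i <- lsupp f) f i * g (n - i).
  by rewrite [LHS]lmul_funE.
rewrite (levalE (A := A)); last first.
  move=> n nA; rewrite fgE big_seq big1 // => i fi.
  by rewrite (gA i) ?mulr0.
under eq_bigr do rewrite fgE rmorph_sum big_distrl /=.
rewrite exchange_big /= (levalE (@lsuppP _ f)) big_distrl /=.
rewrite big_seq [RHS]big_seq; apply: eq_bigr => i fi.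
rewrite [leval g](@reindex_fsbigT _ _ _ _ _ (fun n : int => n - i)); last first.
  by exists (fun n : int => n + i) => n; rewrite ?addrK ?subrK.
rewrite (@fsbigTE _ _ _ _ A); last first.
  by move=> n /(gA _ _ fi) ->; rewrite rmorph0 mul0r.
rewrite big_distrr; apply: eq_bigr => n _ /=.
have yE : y n = y (n - i) * y i by rewrite -yD subrK.
rewrite rmorphM yE -!mulrA; congr (_ * _).
by rewrite mulrA [LHS]mulrC.
Qed.

Lemma leval_nmod_morphism : nmod_morphism leval.
Proof. by split; [exact: leval0|exact: levalD]. Qed.

Lemma leval_monoid_morphism : monoid_morphism leval.
Proof.
split; last exact: levalM.
by rewrite [LHS]leval_mono rmorph1 y0 mulr1.
Qed.

Definition leval_rmorph : {rmorphism laurent S -> S'} :=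
  HB.pack leval (GRing.isNmodMorphism.Build _ _ leval leval_nmod_morphism)
                (GRing.isMonoidMorphism.Build _ _ leval leval_monoid_morphism).

End LaurentEval.

(** * Quotients with the same image *)

Section QuotientIso.
Variables (R : pzSemiRingType) (A B : comSemiAlgType R) (S : comPzSemiRingType).
Variables (alpha : {rmorphism A -> S}) (beta : {rmorphism B -> S}).
Variables (CA : congruence A) (CB : congruence B).
Hypothesis CAP : forall x y, congr_set CA (x, y) <-> alpha x = alpha y.
Hypothesis CBP : forall x y, congr_set CB (x, y) <-> beta x = beta y.
Hypothesis imAB : forall a, exists b, alpha a = beta b.
Hypothesis imBA : forall b, exists a, alpha a = beta b.
Hypothesis scaleAB : forall k a b, alpha a = beta b ->
  alpha (k *: a) = beta (k *: b).

(** Both quotients embed in S with the same image. The maps alpha and beta need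
    not be linear: it suffices that they treat scalars in the same way. *)
Lemma quot_isoalg : quot CA \isoalg quot CB.
Proof.
have /choice[F FP] (x : quot CA) : exists z : quot CB,
    forall a b, x = qpi CA a -> alpha a = beta b -> z = qpi CB b.
  have [b ab] := imAB (repr x); exists (qpi CB b) => a b' xa ab'.
  apply/qpiP/CBP; rewrite -ab -ab'; apply/CAP/qpiP.
  by rewrite qpi_repr.
have FE a b : alpha a = beta b -> F (qpi CA a) = qpi CB b by exact: FP.
have Fadd : nmod_morphism F.
  split; first by apply: FE; rewrite !rmorph0.
  elim/qpi_ind=> a; elim/qpi_ind=> a'.
  have [b ab] := imAB a; have [b' ab'] := imAB a'.
  rewrite -qpiD (FE _ _ ab) (FE _ _ ab') -qpiD.
  by apply: FE; rewrite !rmorphD ab ab'.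
have Fmul : monoid_morphism F.
  split; first by apply: FE; rewrite !rmorph1.
  elim/qpi_ind=> a; elim/qpi_ind=> a'.
  have [b ab] := imAB a; have [b' ab'] := imAB a'.
  rewrite -qpiM (FE _ _ ab) (FE _ _ ab') -qpiM.
  by apply: FE; rewrite !rmorphM ab ab'.
pose f : {rmorphism quot CA -> quot CB} :=
  HB.pack F (GRing.isNmodMorphism.Build _ _ F Fadd)
            (GRing.isMonoidMorphism.Build _ _ F Fmul).
exists f; split; last first.
  move=> k; elim/qpi_ind=> a; have [b ab] := imAB a.
  rewrite /= (FE _ _ ab) -!qpiZ; apply: FE; exact: scaleAB.
have /choice[H HP] (z : quot CB) : exists x : quot CA, F x = z.
  elim/qpi_ind: z => b; have [a ab] := imBA b.
  by exists (qpi CA a); exact: FE.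
exists H => // x; elim/qpi_ind: x => a /=.
have := HP (F (qpi CA a)); elim/qpi_ind: (H _) => a'.
have [b ab] := imAB a; have [b' ab'] := imAB a'.
rewrite (FE _ _ ab) (FE _ _ ab') => /qpiP/CBP bb'.
by apply/qpiP/CAP; rewrite ab ab'.
Qed.

End QuotientIso.

(** * The model quotients of types I-1 and I-2 *)

Section Tropical.
Variable R : realType.
Implicit Types a b c : trop R.

Lemma trop_addxx a : a + a = a.
Proof. by apply: val_inj; exact: maxxx. Qed.

Lemma tropP a : a = 0 \/ exists r, a = tfin r.
Proof.
case: a => [[r| //|] ra]; [right; exists r|left]; exact: val_inj.
Qed.

Lemma tfinD (r s : R) : tfin r + tfin s = tfin (Num.max r s).
Proof. by apply: val_inj; rewrite /= EFin_max. Qed.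

Lemma tfinM (r s : R) : tfin r * tfin s = tfin (r + s).
Proof. exact: val_inj. Qed.

Lemma tfin_inj : injective (@tfin R). Proof. by move=> r s []. Qed.

(** This is the primality of the kernel of any morphism to the tropical
    semifield. *)
Lemma trop_twisted a b c d : a * c + b * d = a * d + b * c -> a = b \/ c = d.
Proof.
have [->|[ra ->]] := tropP a; have [->|[rb ->]] := tropP b;
  have [->|[rc ->]] := tropP c; have [->|[rd ->]] := tropP d;
  rewrite ?(mul0r, mulr0, addr0, add0r, tfinM, tfinD); try by [left|right];
  try by move=> /(congr1 val).
- by move=> /tfin_inj/addrI ->; right.
- by move=> /tfin_inj/addrI ->; right.
- by move=> /tfin_inj/addIr ->; left.
- by move=> /tfin_inj/addIr ->; left.
move=> /tfin_inj h; have [->|ab] := eqVneq ra rb; first by left.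
have [->|cd] := eqVneq rc rd; first by right.
exfalso; move: h; rewrite /Num.max; case: ltP => h1; case: ltP => h2 h.
- by case/eqP: cd; lra.
- by case/eqP: ab; lra.
- by case/eqP: ab; lra.
- by case/eqP: cd; lra.
Qed.

(** The endomorphism of T that identifies all nonzero constants. *)
Definition triv a : trop R := if a == 0 then 0 else 1.

Lemma triv_nmod_morphism : nmod_morphism triv.
Proof.
split=> [|a b]; first by rewrite /triv eqxx.
have [->|[ra ->]] := tropP a; first by rewrite /triv add0r eqxx add0r.
have [->|[rb ->]] := tropP b; first by rewrite /triv addr0 eqxx addr0.
by rewrite tfinD [RHS]trop_addxx.
Qed.

Lemma triv_monoid_morphism : monoid_morphism triv.
Proof.
split=> [|a b]; first by [].
have [->|[ra ->]] := tropP a; first by rewrite /triv mul0r eqxx mul0r.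
have [->|[rb ->]] := tropP b; first by rewrite /triv mulr0 eqxx mulr0.
by rewrite tfinM [RHS]mul1r.
Qed.

HB.instance Definition _ :=
  GRing.isNmodMorphism.Build _ _ triv triv_nmod_morphism.
HB.instance Definition _ :=
  GRing.isMonoidMorphism.Build _ _ triv triv_monoid_morphism.

(** Y^m at the point t of the tropical line: the tropical power of t is the
    real multiple m t. *)
Definition texp (t : R) (m : int) : trop R := tfin (m%:~R * t).

Lemma texp0 t : texp t 0 = 1.
Proof. by apply: val_inj; rewrite /= mul0r. Qed.

Lemma texpD t m n : texp t (m + n) = texp t m * texp t n.
Proof. by rewrite /texp tfinM rmorphD /= mulrDl. Qed.

Definition teval (t : R) : {rmorphism laurent (trop R) -> trop R} :=
  leval_rmorph idfun (texp0 t) (texpD t).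

(** Forgetting the coefficients and evaluating Y at the real number 1 leaves
    the maximum of the exponents. *)
Definition tdeg : {rmorphism laurent (trop R) -> trop R} :=
  leval_rmorph triv (texp0 1) (texpD 1).

Lemma teval_mono t (a : R) m : teval t (Ymono a m) = tfin (a + m%:~R * t).
Proof. by rewrite [LHS]leval_mono [LHS]tfinM. Qed.

Lemma tdeg_mono (a : R) m : tdeg (Ymono a m) = tfin m%:~R.
Proof. by rewrite [LHS]leval_mono [LHS]mul1r /texp mulr1. Qed.

(** At a large t the term with the larger exponent dominates, so the generators
    of P(U(1,0;2)) are pairs of functions that agree near +oo. *)
Lemma PU2_teval f g : congr_set (@PU2 R) (f, g) ->
  \forall t \near +oo, teval t f = teval t g.
Proof.
move=> C; apply: (C (near_congruence (F := +oo) teval)).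
move=> _ [a1 [a2 [m1 [m2 [m21 ->]]]]].
suff [M MP] : exists M, forall t, M <= t -> a2 + m2%:~R * t <= a1 + m1%:~R * t.
  near=> t; have: M <= t; last first.
    by move/MP => ?; rewrite [LHS](rmorphD (teval t)) !teval_mono tfinD max_l.
  by near: t; apply: nbhs_pinfty_ge; exact: num_real.
case: m21 => [m21|[-> a21]]; last by exists 0 => t _; rewrite lerD2r.
have d0 : 0 < (m1 - m2)%:~R :> R by rewrite ltr0z subr_gt0.
exists ((a2 - a1) / (m1 - m2)%:~R) => t.
rewrite ler_pdivrMr // rmorphB /= => h; rewrite -subr_ge0; move: h.
by rewrite -subr_ge0; congr (0 <= _); lra.
Unshelve. all: by end_near. Qed.

Lemma PZ1_tdeg f g : congr_set (@PZ1 R) (f, g) -> tdeg f = tdeg g.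
Proof.
move=> C; apply: (C (ker_congruence tdeg)) => _ [a1 [a2 [m1 [m2 [m21 ->]]]]].
suff E : tdeg (Ymono a1 m1 + Ymono a2 m2) = tdeg (Ymono a1 m1) by exact: E.
by rewrite rmorphD !tdeg_mono tfinD max_l // ler_int.
Qed.

Lemma PZ1_Ymono (a b : R) m :
  congr_set (@PZ1 R) (Ymono a m, Ymono b m).
Proof.
apply: (@congr_trans _ _ (Ymono a m + Ymono b m)).
  by apply: congr_sym => C; apply; exists a, b, m, m.
by rewrite addrC => C; apply; exists b, a, m, m.
Qed.

Lemma PZ1_YmonoD m n :
  congr_set (@PZ1 R) (Ymono 0 m + Ymono 0 n, Ymono 0 (Num.max m n)).
Proof.
wlog mn : m n / n <= m => [W|].
  case/orP: (le_total n m) => [/W//|/W].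
  by rewrite addrC maxC.
by rewrite max_l // => C; apply; exists 0, 0, m, n.
Qed.

Lemma laurent_sum (f : laurent (trop R)) :
  f = \sum_(n <- lsupp f) lmono (f n) n.
Proof.
apply: laurent_eq => n.
have -> : (\sum_(m <- lsupp f) lmono (f m) m) n =
    \sum_(m <- lsupp f) lmono_fun (f m) m n.
  by apply: (big_morph (fun g : laurent (trop R) => g n)).
rewrite /lmono_fun.
have [nf|nf] := boolP (n \in lsupp f).
  rewrite (bigD1_seq n) //= ?eqxx ?fset_uniq // big1 ?addr0 // => m.
  by rewrite eq_sym => /negbTE ->.
rewrite (lsuppP nf) big_seq big1 // => m mf.
by case: eqP => // nm; rewrite nm mf in nf.
Qed.

(** Modulo P(Z(1)) each monomial loses its coefficient, and a sum of monomials
    is its term of highest degree. *)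
Lemma PZ1_normal (f : laurent (trop R)) :
  f = 0 \/ exists m, congr_set (@PZ1 R) (f, Ymono 0 m).
Proof.
pose normal g := g = 0 \/ exists m, congr_set (@PZ1 R) (g, Ymono 0 m).
suff : normal f by [].
rewrite (laurent_sum f); apply: (big_ind normal).
- by left.
- move=> g h [->|[m gm]]; first by rewrite add0r.
  move=> [->|[n hn]]; first by rewrite addr0; right; exists m.
  right; exists (Num.max m n).
  exact: congr_trans (congrD gm hn) (PZ1_YmonoD m n).
move=> n _; have [->|[r ->]] := tropP (f n).
  by left; apply: laurent_eq => k; rewrite /= /lmono_fun; case: ifP.
by right; exists n; exact: PZ1_Ymono.
Qed.

Lemma PZ1P f g : congr_set (@PZ1 R) (f, g) <-> tdeg f = tdeg g.
Proof.
split; first exact: PZ1_tdeg.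
have [->|[m fm]] := PZ1_normal f; have [->|[n gn]] := PZ1_normal g.
- by move=> _; exact: congr_refl.
- by rewrite rmorph0 (PZ1_tdeg gn) tdeg_mono => /eqP; rewrite eq_sym.
- by rewrite rmorph0 (PZ1_tdeg fm) tdeg_mono.
rewrite (PZ1_tdeg fm) (PZ1_tdeg gn) !tdeg_mono => /tfin_inj/eqP.
rewrite eqr_int => /eqP mn; apply: (congr_trans fm).
by rewrite mn; exact: congr_sym.
Qed.

End Tropical.

Arguments tdeg {R}.

Section TypeConsequences.
Variables (R : realType) (K : comSemiAlgType (trop R)).
Implicit Types P : congruence K.

Lemma scale_laurent1 (S : comNzSemiRingType) (a : S) :
  a *: (1 : laurent S) = lmono a 0.
Proof. exact: mulr1. Qed.

Lemma type_I2_unbounded P : type_I2 P ->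
  exists u : quot P, forall a : R, nle (tfin a *: (1 : quot P)) u.
Proof.
move=> [_ [f [[g fK gK] fZ]]]; exists (g (qpi _ (Ymono 0 1))) => a.
apply: (can_inj fK); rewrite rmorphD fZ rmorph1 gK -qpiZ -qpiD scale_laurent1.
apply/qpiP; rewrite addrC => C; apply; exists 0, a, 1, 0.
by split; [left|].
Qed.

Lemma type_I2_cst_inj P : type_I2 P ->
  injective (fun a : R => tfin a *: (1 : quot P)).
Proof.
move=> [_ [f [_ fZ]]] a b /(congr1 f).
rewrite !fZ rmorph1 -!qpiZ !scale_laurent1.
move=> /qpiP/PU2_teval E.
near (+oo : set_system R) => t.
have : teval t (Ymono a 0) = teval t (Ymono b 0) by near: t.
by rewrite !teval_mono !mul0r !addr0 => /tfin_inj.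
Unshelve. all: by end_near. Qed.

Lemma type_I1_cst P : type_I1 P -> forall a : R, tfin a *: (1 : quot P) = 1.
Proof.
move=> [_ [f [[g fK _] fZ]]] a; apply: (can_inj fK); rewrite fZ rmorph1.
by rewrite -qpiZ scale_laurent1; apply/qpiP; exact: PZ1_Ymono.
Qed.

Lemma type_I1_unbounded P : type_I1 P -> exists u : quot P, ~ nle u 1.
Proof.
move=> [_ [f [[g fK gK] _]]]; exists (g (qpi _ (Ymono 0 1))).
move=> /(congr1 f); rewrite rmorphD rmorph1 gK -qpiD => /qpiP/PZ1_tdeg.
rewrite rmorphD [X in _ + X](_ : _ = tdeg (Ymono 0 0)) // !tdeg_mono tfinD.
move=> /tfin_inj/eqP.
by rewrite max_l // ?oner_eq0 // ler01.
Qed.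

End TypeConsequences.

(** * Truncated distance functions *)

Section CutDistance.
Variables (R : realType) (G : metric_graph R).
Implicit Types (e : edge G) (N : edge G -> \bar R).

(** On an infinite edge e this is the distance from the finite end of e, cut at
    the height N e; it is 0 on the rest of the curve. The heights +oo give
    slope 1 at infinity, the finite ones slope 0. *)
Definition cutdist N (x : curve G) : \bar R :=
  match x with
  | inl v => if [pick e | (len e == +oo%E) && (tgt e == v)] is Some e
             then N e else 0%E
  | inr p => let: (e, t) := val p in
             if len e == +oo%E then mine t%:E (N e) else 0%E
  end.

Lemma param_domP e t : edge_dom e t ->
  [\/ t = 0%E /\ param e t = inl (src e),
      [/\ t = len e, (0 < t)%E & param e t = inl (tgt e)] |
      exists2 p : edge_interior G, val p = (e, fine t) &
        param e t = inr p /\ t = (fine t)%:E].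
Proof.
rewrite /edge_dom /= => /andP[t0 tl].
move: t0; rewrite le_eqVlt => /predU1P[<-|t0].
  by constructor 1; rewrite /param lexx.
have [tE|tl'] := eqVneq t (len e).
  constructor 2; split=> //; rewrite /param leNgt t0 /= insubF //=.
  move: t0 tl; rewrite tE; case: (len e) => [r| |] //=.
    by rewrite ltxx andbF.
  by rewrite ltxx.
have tlt : (t < len e)%E by rewrite lt_neqAle tl' tl.
constructor 3; have tf : t = (fine t)%:E.
  by move: t0 tlt; case: (t) => // _; rewrite ltNge leey.
rewrite tf in tlt; rewrite tf lte_fin in t0.
have h : (0 < (e, fine t).2) && (((e, fine t).2)%:E < len (e, fine t).1)%E.
  by rewrite /= t0 tlt.
exists (Sub (e, fine t) h : edge_interior G) => //.
split=> //; rewrite /param leNgt {1}tf lte_fin t0 /= insubT.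
by congr inr; apply: val_inj.
Qed.

Lemma cutdistE N e t : (forall e, 0 <= N e)%E -> edge_dom e t ->
  cutdist N (param e t) = if len e == +oo%E then mine t (N e) else 0%E.
Proof.
move=> N0 te; case: (param_domP te) => [[t0 ->]|[tE t0 ->]|[p pE [-> tE]]].
- rewrite /= t0 min_l ?if_same; last exact: N0.
  case: pickP => // e' /andP[/eqP le' /eqP ee'].
  have [see oee] := len_pinfty le'; have [ee|/oee[]] := eqVneq e e'.
    by rewrite ee' ee eqxx in see.
  by rewrite ee' eqxx.
- rewrite /=; case: pickP => [e' /andP[/eqP le' /eqP ee']|H].
    have [_ oee] := len_pinfty le'; have [ee|/oee[_]] := eqVneq e e'.
      by rewrite ee le' eqxx tE ee le' min_r // leey.
    by rewrite ee' eqxx.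
  by case: eqP => // le; have := H e; rewrite le !eqxx.
by rewrite /= pE -tE.
Qed.

Lemma cutdist_ge0 N x : (forall e, 0 <= N e)%E -> (0 <= cutdist N x)%E.
Proof.
move=> N0; case: x => [v|[[e t] /= h]] /=; first by case: pickP.
case: ifP => // _; rewrite le_min N0 andbT lee_fin.
by case/andP: h => /ltW.
Qed.

Lemma cutdist_continuous N : (forall e, 0 <= N e)%E -> continuous (cutdist N).
Proof.
move=> N0; apply/continuousP => U oU.
suff : curve_open (cutdist N @^-1` U) by []; move=> e.
apply/open_subspaceP.
have [le|le] := eqVneq (len e) +oo%E.
  exists ((fun t => mine t (N e)) @^-1` U).
    suff /continuousP : continuous (fun t : \bar R => mine t (N e)) by exact.
    apply: min_fun_continuous; first by move=> ?; exact: cvg_id.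
    exact: cst_continuous.
  apply/seteqP; split=> t [] /= Ut te; split=> //; move: Ut;
    by rewrite cutdistE // le eqxx.
have [U0|U0] := pselect (U 0%E); [exists setT|exists set0].
- exact: openT.
- apply/seteqP; split=> t [] /= Ut te; split=> //.
  by rewrite cutdistE // (negbTE le).
- exact: open0.
- apply/seteqP; split=> t [] //= Ut te; exfalso; apply: U0.
  by move: Ut; rewrite cutdistE // (negbTE le).
Qed.

Lemma cutdist_finite N x : (forall e, 0 <= N e)%E -> finite_pt x ->
  cutdist N x \is a fin_num.
Proof.
move=> N0; case: x => [v|[[e t] /= h]] /= fx.
  case: pickP => // e /andP[/eqP le /eqP ev]; exfalso; apply: fx.
  by exists e; rewrite // param_pinfty ev.
case: ifP => // _; rewrite /mine; case: ifP => // /negbT; rewrite -leNgt => Nt.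
by rewrite fin_real //; apply/andP; split;
  [exact: lt_le_trans (N0 e)|exact: le_lt_trans Nt (ltry _)].
Qed.

Lemma cutdist_rational N : (forall e, 0 <= N e)%E -> rational (cutdist N).
Proof.
move=> N0; right; split; first exact: cutdist_continuous.
  by move=> x; exact: cutdist_finite.
move=> e; have [le|le] := eqVneq (len e) +oo%E; last first.
  exists [:: (`]-oo, +oo[, (0, 0))] => t t0 tl; split.
    by exists (`]-oo, +oo[, (0, 0)); rewrite ?mem_head // in_itv.
  move=> p; rewrite mem_seq1 => /eqP -> _ /=.
  rewrite cutdistE // ?(negbTE le) ?mul0r ?addr0 //.
  by rewrite /edge_dom /= lee_fin t0 tl.
case NE : (N e) => [n| |]; last by have := N0 e; rewrite NE.
  exists [:: (`]-oo, n], (1, 0)); (`[n, +oo[, (0, n))] => t t0 tl; split.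
    have [tn|tn] := leP t n.
      by exists (`]-oo, n], (1, 0)); rewrite ?mem_head // in_itv.
    exists (`[n, +oo[, (0, n)); first by rewrite inE mem_head orbT.
    by rewrite in_itv /= andbT ltW.
  have te : edge_dom e t%:E by rewrite /edge_dom /= lee_fin t0 tl.
  move=> p; rewrite in_cons mem_seq1 => /orP[]/eqP ->;
    rewrite in_itv /= ?andbT => tn; rewrite cutdistE // le eqxx NE.
    by rewrite min_l ?lee_fin // mul1r addr0.
  by rewrite min_r ?lee_fin // mul0r add0r.
exists [:: (`]-oo, +oo[, (1, 0))] => t t0 tl; split.
  by exists (`]-oo, +oo[, (1, 0)); rewrite ?mem_head // in_itv.
have te : edge_dom e t%:E by rewrite /edge_dom /= lee_fin t0 tl.
move=> p; rewrite mem_seq1 => /eqP -> _ /=.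
by rewrite cutdistE // le eqxx NE min_l ?leey // mul1r addr0.
Qed.

End CutDistance.

Section EdgeRay.
Variables (R : realType) (G : metric_graph R) (e : edge G).
Hypothesis le : len e = +oo%E.

(** This coordinate along e, whose values lie in a Hausdorff space, identifies
    limits of points on e without separation properties of the curve. *)
Definition edist : curve G -> \bar R :=
  cutdist (fun e' => if e' == e then +oo%E else 0%E).

Lemma edist_ge0_subproof (e' : edge G) :
  (0 <= (if e' == e then +oo else 0 : \bar R))%E.
Proof. by case: ifP. Qed.

Lemma dom_infty (t : \bar R) : (0 <= t)%E -> edge_dom e t.
Proof. by rewrite /edge_dom /= le leey andbT. Qed.

Lemma edist_param t : (0 <= t)%E -> edist (param e t) = t.
Proof.
move=> /dom_infty te; rewrite [LHS]cutdistE //; last exact: edist_ge0_subproof.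
by rewrite le !eqxx min_l ?leey.
Qed.

Lemma edist_gt0 x : (0 < edist x)%E -> x = param e (edist x).
Proof.
case: x => [v|[[e' t] /= h]]; rewrite /edist /=.
  case: pickP => [e' /andP[/eqP le' /eqP ev]|]; last by rewrite ltxx.
  case: eqP => [ee|]; last by rewrite ltxx.
  by subst e'; rewrite param_pinfty ev.
case: ifP => [/eqP le'|]; last by rewrite ltxx.
case: (eqVneq e' e) => ee; last first.
  by rewrite min_r ?ltxx // lee_fin ltW //; case/andP: h.
subst e'; rewrite min_l ?leey // lte_fin => t0.
rewrite /param leNgt lte_fin t0 /= insubT.
by congr inr; apply: val_inj.
Qed.

Lemma edist_continuous : continuous edist.
Proof. exact/cutdist_continuous/edist_ge0_subproof. Qed.

Lemma param_inj (s t : R) : 0 <= s -> 0 <= t ->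
  param e s%:E = param e t%:E -> s = t.
Proof.
move=> s0 t0 /(congr1 edist); rewrite !edist_param ?lee_fin //.
by case.
Qed.

Lemma param_cvg (tau : R) : 0 <= tau ->
  param e t%:E @[t --> within [set t | 0 <= t] (nbhs tau)] --> param e tau%:E.
Proof.
move=> tau0 U; rewrite nbhsE => -[B [oB Bx] BU].
have /open_subspaceP[V oV VB] := oB e.
have Vtau : V tau%:E.
  have [] // : (V `&` edge_dom e) tau%:E.
  by rewrite VB; split=> //; apply: dom_infty; rewrite lee_fin.
have : \forall t \near tau, V t%:E.
  by have : nbhs tau%:E V by exact: open_nbhs_nbhs.
apply: filterS => t Vt t0; apply: BU.
have [] // : (param e @^-1` B `&` edge_dom e) t%:E.
by rewrite -VB; split=> //; apply: dom_infty; rewrite lee_fin.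
Qed.

(** On another edge, the preimage of e consists of those ends that are glued to
    the initial vertex of e. *)
Lemma closed_edge : closed (param e @` [set t | 0 <= t]%E).
Proof.
rewrite -openC; suff : curve_open (~` (param e @` [set t | 0 <= t]%E)) by [].
move=> e'; apply/open_subspaceP.
have [->|ee'] := eqVneq e' e.
  exists set0; first exact: open0.
  apply/seteqP; split=> t [] //= H te; exfalso; apply: H; exists t => //.
  by move: te; rewrite /edge_dom /= => /andP[].
have inE t : edge_dom e' t ->
    (param e @` [set t | 0 <= t]%E) (param e' t) <-> param e' t = inl (src e).
  move=> te; split=> [[u /= u0 ue]|->]; last first.
    by exists 0%E => //=; rewrite /param lexx.
  move: u0; rewrite le_eqVlt => /predU1P[u0|u0].
    by rewrite -ue -u0 /param lexx.
  have [] := param_inj_pos le u0 _ (esym ue); first by rewrite mem_set.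
  by move=> ee _; rewrite ee eqxx in ee'.
pose V1 : set (\bar R) := if src e' == src e then [set t | 0 < t]%E else setT.
pose V2 : set (\bar R) :=
  if tgt e' == src e then [set t | t < len e']%E else setT.
exists (V1 `&` V2).
  apply: openI; rewrite /V1 /V2; case: ifP => _; try exact: openT.
    exact: open_ereal_gt_ereal.
  exact: open_ereal_lt_ereal.
apply/seteqP; split=> t [] /= h te; split=> //.
  move=> /(inE _ te) E; move: h; rewrite /V1 /V2.
  case: (param_domP te) => [[t0]|[tE t0]|[p _ [+ _]]]; rewrite E //.
    by move=> [->]; rewrite eqxx t0 /= ltxx => -[].
  by move=> [->]; rewrite eqxx -tE /= ltxx => -[].
have {}h : param e' t <> inl (src e) by move/(inE _ te).
have /andP[t0 tl] := te.
split; rewrite /V1 /V2; case: eqP => //= E; rewrite lt_neqAle ?t0 ?tl andbT.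
  by apply/eqP => t0'; apply: h; rewrite -t0' /param lexx E.
apply/eqP => tE; apply: h; rewrite -E.
case: (param_domP te) => [[t0' ->]|[_ _ ->]|[p pE [-> _]]] //.
  by have := len_gt0 e'; rewrite -tE t0' ltxx.
case: p pE => -[e1 t1] /= h1 [E1 E2]; subst e1 t1.
by exfalso; move: h1; rewrite -tE; case: (t) => [r| |] /=; rewrite ltxx ?andbF.
Qed.

End EdgeRay.

(** * Rays and their ends *)

Section LeftPieces.
Variable R : realType.

Lemma itv_left (i : interval R) (tau : R) :
  (\forall t \near tau^'-, t \in i) \/ (\forall t \near tau^'-, t \notin i).
Proof.
have below (x : R) : x < tau -> \forall t \near tau^'-, x < t.
  by move=> xt; exact: nbhs_left_gt.
have lt_tau : \forall t \near tau^'-, t < tau by exact: nbhs_left_lt.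
case: i => l u.
have [lP|lP] : (\forall t \near tau^'-, (l <= BLeft t)%O) \/
    (\forall t \near tau^'-, ~~ (l <= BLeft t)%O).
  case: l => [b x|[]]; last by right; near=> t.
    have [xt|tx] := ltP x tau; [left|right]; near=> t.
      have : x < t by near: t; exact: below.
      by case: b; rewrite bnd_simp //; exact: ltW.
    have : t < x by apply: lt_le_trans tx; near: t.
    by case: b; rewrite bnd_simp -?leNgt -?ltNge // => /ltW.
  by left; near=> t.
- have [uP|uP] : (\forall t \near tau^'-, (BRight t <= u)%O) \/
      (\forall t \near tau^'-, ~~ (BRight t <= u)%O).
    case: u => [b x|[]]; first 1 last.
    + by right; near=> t.
    + by left; near=> t.
    have [xt|tx] := ltP x tau; [right|left]; near=> t.
      have : x < t by near: t; exact: below.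
      by case: b; rewrite bnd_simp -?leNgt -?ltNge // => /ltW.
    have : t < x by apply: lt_le_trans tx; near: t.
    by case: b; rewrite bnd_simp // => /ltW.
  + left; near=> t; rewrite itv_boundlr; apply/andP; split; by near: t.
  + right; near=> t; rewrite itv_boundlr negb_and; apply/orP; right; by near: t.
- by right; near=> t; rewrite itv_boundlr negb_and; apply/orP; left; near: t.
Unshelve. all: by end_near. Qed.

(** An interval contains a left neighborhood of tau or misses one; a finite
    cover cannot miss a left neighborhood with all its members. *)
Lemma piecewise_left (A : eqType) (l : \bar R) (P : A -> R -> Prop) (tau : R) :
  0 < tau -> (tau%:E <= l)%E -> piecewise l P ->
  exists a, \forall t \near tau^'-, P a t.
Proof.
move=> tau0 tl [s sP].
have : (exists2 p, p \in s & \forall t \near tau^'-, t \in p.1) \/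
    (\forall t \near tau^'-, forall p, p \in s -> t \notin p.1).
  elim: s {sP} => [|p s IH]; first by right; near=> t.
  have [pP|pP] := itv_left p.1 tau; first by left; exists p; rewrite ?mem_head.
  case: IH => [[q qs qP]|IH]; first by left; exists q; rewrite // inE qs orbT.
  right; near=> t => q; rewrite inE => /predU1P[->|qs]; first by near: t.
  by have /(_ t) := near IH; apply=> //.
have dom : \forall t \near tau^'-, 0 <= t /\ (t%:E <= l)%E.
  near=> t; split; first by apply: ltW; near: t; exact: nbhs_left_gt.
  apply: le_trans tl; rewrite lee_fin; apply: ltW.
  by near: t; exact: nbhs_left_lt.
move=> [[p ps pP]|none]; last first.
  near (tau^'-) => t.
  have [t0 tl'] : 0 <= t /\ (t%:E <= l)%E by near: t.
  have [[p ps tp] _] := sP t t0 tl'.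
  have noneT : forall q, q \in s -> t \notin q.1 by near: t.
  by have := noneT _ ps; rewrite tp.
exists p.2; near=> t.
have [t0 tl'] : 0 <= t /\ (t%:E <= l)%E by near: t.
have [_ H] := sP t t0 tl'; apply: H => //.
by near: t.
Unshelve. all: by end_near. Qed.

End LeftPieces.

Section RayShift.
Variables (R : realType) (G G' : metric_graph R) (h : curve G' -> curve G).
Variable e' : edge G'.
Hypothesis hh : curve_isometry h.
Hypothesis le' : len e' = +oo%E.

Let r (t : \bar R) := h (param e' t).

Lemma isometry_cvg (tau : R) : 0 <= tau ->
  r t%:E @[t --> within [set t | 0 <= t] (nbhs tau)] --> r tau%:E.
Proof.
case: hh => ch _ _ tau0 U /(ch _) hU.
exact: (param_cvg le' tau0 hU).
Qed.

Lemma isometry_cvg_right (tau : R) : 0 <= tau ->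
  r t%:E @[t --> tau^'+] --> r tau%:E.
Proof.
move=> tau0 U rU; have := isometry_cvg tau0 rU.
rewrite /at_right; rewrite /= !nbhs_simpl /within /=.
apply: filterS => t H tt; apply: H; exact: le_trans tau0 (ltW tt).
Qed.

Lemma isometry_cvg_left (tau : R) : 0 < tau ->
  r t%:E @[t --> tau^'-] --> r tau%:E.
Proof.
move=> tau0 U rU; have := isometry_cvg (ltW tau0) rU.
rewrite /at_left; rewrite /= !nbhs_simpl /within /= => H.
near=> t => _; have : 0 <= t -> U (r t%:E) by near: t.
by apply; apply: ltW; near: t; exact: lt_nbhsr.
Unshelve. all: by end_near. Qed.

Lemma isometry_inj (s t : R) : 0 <= s -> 0 <= t -> r s%:E = r t%:E -> s = t.
Proof.
case: hh => _ [k _ [hk _]] _ s0 t0 /(congr1 k); rewrite !hk.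
exact: param_inj.
Qed.

(** A last piece covers a neighborhood of +oo. It cannot run backwards, because
    its parameter stays nonnegative; running forwards forever, it needs an edge
    of infinite length. *)
Lemma isometry_tail : exists (e : edge G) (c T : R),
  [/\ len e = +oo%E, 0 <= T, 0 <= T + c &
      forall t, T <= t -> r t%:E = param e (t + c)%:E].
Proof.
case: hh => _ _ /(_ e'); rewrite le' => /piecewise_tail[[[e b] c]] H.
have [T0 [_ T0P]] := H.
pose T := Num.max (Num.max (T0 + 1) 0) (- c).
have TP t : T <= t -> exists u : R, [/\ u = (-1) ^+ b * t + c, 0 <= u,
    (u%:E <= len e)%E & r t%:E = param e u%:E].
  rewrite /T !ge_max => /andP[/andP[t1 _] _]; apply: T0P.
  by apply: lt_le_trans t1; rewrite ltrDl.
have b0 : b = false.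
  apply/negbTE/negP => bT; rewrite bT in TP.
  have := TP (Num.max T (c + 1)); rewrite le_max lexx => /(_ isT)[u [-> + _ _]].
  have : c + 1 <= Num.max T (c + 1) by rewrite le_max lexx orbT.
  rewrite expr1 mulN1r => h1 h2; have : 0 < 1 :> R by [].
  by move: h1 h2; set x := Num.max _ _; lra.
rewrite b0 in TP.
exists e, c, T; split.
- apply/eqyP => A A0.
  have := TP (Num.max T (A - c)).
  rewrite le_max lexx => /(_ isT)[u [-> _ ul _]].
  apply: le_trans ul; rewrite lee_fin expr0 mul1r -lerBlDr.
  by rewrite le_max lexx orbT.
- by rewrite /T !le_max lexx orbT.
- by rewrite -lerBlDr sub0r /T le_max lexx orbT.
- by move=> t /TP[u [-> _ _ ->]]; rewrite expr0 mul1r.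
Qed.

Variables (e : edge G) (c : R).
Hypothesis le : len e = +oo%E.

Let agree (tau : R) := forall t, tau <= t -> r t%:E = param e (t + c)%:E.

Lemma agree_edist tau : 0 <= tau -> 0 <= tau + c ->
  (forall t, tau < t -> r t%:E = param e (t + c)%:E) ->
  edist e (r tau%:E) = (tau + c)%:E.
Proof.
move=> tau0 tauc eqr.
have cv : edist e (r t%:E) @[t --> tau^'+] --> edist e (r tau%:E).
  by move=> U /(@edist_continuous _ _ e) rU; exact: isometry_cvg_right rU.
apply: (cvg_unique _ cv); first exact: ereal_hausdorff.
have cv' : (t + c)%:E @[t --> tau^'+] --> (tau + c)%:E.
  apply: cvg_EFin; first by near=> t.
  apply: cvgD; last exact: cvg_cst.
  exact: cvg_at_right_filter.
apply: cvg_trans cv'; apply: near_eq_cvg; near=> t.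
have tt : tau < t by near: t; exact: nbhs_right_gt.
rewrite eqr // edist_param // lee_fin.
by apply: le_trans tauc _; rewrite lerD2r ltW.
Unshelve. all: by end_near. Qed.

(** Continuity gives the coordinate of the limit point along e. That the limit
    point lies on e needs closedness of e in case it is the initial vertex,
    where the coordinate is 0 and does not determine the point. *)
Lemma agree_closed tau : 0 <= tau -> 0 <= tau + c ->
  (forall t, tau < t -> r t%:E = param e (t + c)%:E) -> agree tau.
Proof.
move=> tau0 tauc eqr s; rewrite le_eqVlt => /predU1P[<-|]; last exact: eqr.
have dE := agree_edist tau0 tauc eqr.
have : (param e @` [set t | 0 <= t]%E) (r tau%:E).
  apply: (@closed_cvg _ _ _ (at_right_proper_filter tau) (fun t => r t%:E) _
    (closed_edge le) _ _ (isometry_cvg_right tau0)).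
  near=> t; have tt : tau < t by near: t; exact: nbhs_right_gt.
  exists (t + c)%:E; last by rewrite eqr.
  by rewrite /= lee_fin (le_trans tauc) // lerD2r ltW.
by move=> [u u0 uE]; rewrite -uE -dE -[in RHS]uE edist_param.
Unshelve. all: by end_near. Qed.


(** Just before tau the isometry stays in the interior of e, where one piece
    describes it as t |-> t + c or as a reflection. A reflection would map t
    and 2 tau - t to the same point, against injectivity. *)
Lemma agree_extend tau : 0 < tau -> 0 < tau + c -> agree tau ->
  exists2 tau', tau' < tau & [/\ 0 <= tau', 0 <= tau' + c & agree tau'].
Proof.
move=> tau0 tauc eqr.
have cr : edist e (r t%:E) @[t --> tau^'-] --> (tau + c)%:E.
  rewrite -(edist_param le (t := (tau + c)%:E)) ?lee_fin ?ltW //.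
  rewrite -eqr // => U /(@edist_continuous _ _ e) rU.
  exact: isometry_cvg_left rU.
have [_ _ /(_ e')] := hh; rewrite le' => pw.
have [[[e1 b] c1] H] := piecewise_left tau0 (leey _) pw.
have dpos : \forall t \near tau^'-, (0 < edist e (r t%:E))%E.
  by apply: (cr [set u | 0 < u]%E); apply: open_nbhs_nbhs; split;
    [exact: open_ereal_gt_ereal|rewrite /= lte_fin].
have dE : \forall t \near tau^'-, e1 = e /\
    edist e (r t%:E) = ((-1) ^+ b * t + c1)%:E.
  near=> t; have d0 : (0 < edist e (r t%:E))%E by near: t.
  have [u [uE u0 ul ru]] : exists u : R, [/\ u = (-1) ^+ b * t + c1, 0 <= u,
      (u%:E <= len e1)%E & r t%:E = param e1 u%:E] by near: t.
  have [||<- <-] := @param_inj_pos _ _ e e1 (edist e (r t%:E)) u%:E le d0.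
  - by rewrite inE /edge_dom /= lee_fin u0.
  - by rewrite -ru; exact: edist_gt0.
  by split; rewrite // uE.
have bc : (-1) ^+ b * tau + c1 = tau + c.
  have cv : ((-1) ^+ b * t + c1)%:E @[t --> tau^'-] -->
      ((-1) ^+ b * tau + c1)%:E.
    apply: cvg_EFin; first by near=> t.
    apply: cvgD; last exact: cvg_cst.
    by apply: cvgMr; exact: cvg_at_left_filter.
  suff [//] : ((-1) ^+ b * tau + c1)%:E = (tau + c)%:E.
  apply: (cvg_unique _ cv); first exact: ereal_hausdorff.
  apply: cvg_trans cr; apply: near_eq_cvg; near=> t.
  by have [_ ->] : e1 = e /\
    edist e (r t%:E) = ((-1) ^+ b * t + c1)%:E by near: t.
have rE : \forall t \near tau^'-, r t%:E = param e ((-1) ^+ b * t + c1)%:E.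
  near=> t; have [_ <-] : e1 = e /\
    edist e (r t%:E) = ((-1) ^+ b * t + c1)%:E by near: t.
  by apply: edist_gt0; near: t.
case: b {H dE} bc rE => /= bc rE.
  near (tau^'-) => t.
  have tt : t < tau by near: t; exact: nbhs_left_lt.
  have t0 : 0 < t by near: t; exact: nbhs_left_gt.
  have : r t%:E = r (tau + tau - t)%:E.
    rewrite (near rE t) // eqr; last by lra.
    by congr (param e _%:E); move: bc; rewrite !expr1; lra.
  move/isometry_inj; rewrite (ltW t0) => /(_ isT) E.
  have : t = tau + tau - t by apply: E; lra.
  by move=> tE; exfalso; lra.
have c1c : c1 = c by move: bc; rewrite expr0 mul1r => /addrI.
have [d /= d0 dP] : \forall t \near tau, t < tau -> r t%:E = param e (t + c)%:E.
  by move: rE; rewrite expr0 c1c; under eq_near do rewrite mul1r.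
pose t' := Num.max (Num.max 0 (- c)) (tau - d / 2).
have t'tau : t' < tau.
  by rewrite !gt_max tau0 /= ltrBlDr ltrDl divr_gt0 ?ltr0n // andbT; lra.
exists t' => //; split.
- by rewrite !le_max lexx.
- by rewrite -lerBlDr sub0r !le_max lexx orbT.
move=> t t't; have [tt|tt] := leP tau t; first exact: eqr.
apply: dP => //=; rewrite ger0_norm ?subr_ge0 ?ltW //.
have : tau - d / 2 <= t by apply: le_trans t't; rewrite le_max lexx orbT.
by lra.
Unshelve. all: by end_near. Qed.

(** The infimum of the parameters from which on r is the shifted edge can only
    be the point where r or the edge begins. *)
Lemma agree_max tau : 0 <= tau -> 0 <= tau + c -> agree tau ->
  agree (Num.max 0 (- c)).
Proof.
move=> tau0 tauc eqr; set t1 := Num.max 0 (- c).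
have t1P t : (t1 <= t) = (0 <= t) && (0 <= t + c).
  by rewrite ge_max; congr (_ && _); rewrite -[RHS]lerBlDr sub0r.
pose S := [set t | t1 <= t /\ agree t].
have S0 : S !=set0 by exists tau; split=> //; rewrite t1P tau0.
have lbS : lbound S t1 by move=> t [].
have hS : has_inf S by split=> //; exists t1.
have t1i : t1 <= inf S by exact: lb_le_inf.
have /andP[i0 ic] : (0 <= inf S) && (0 <= inf S + c) by rewrite -t1P.
have agi : agree (inf S).
  apply: agree_closed => // t /(inf_lt S0)[s [_ sP] st].
  by apply: sP; exact: ltW.
move: t1i; rewrite le_eqVlt => /predU1P[->//|t1i].
have i0' : 0 < inf S by apply: le_lt_trans t1i; rewrite le_max lexx.
have ic' : 0 < inf S + c.
  by rewrite -ltrBlDr sub0r; apply: le_lt_trans t1i; rewrite le_max lexx orbT.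
have [t' t'i [t'0 t'c agt']] := agree_extend i0' ic' agi.
exfalso; move: t'i; rewrite ltNge => /negP; apply.
by apply: ge_inf; [exists t1|split=> //; rewrite t1P t'0].
Qed.

End RayShift.

Section Rays.
Variables (R : realType) (G : metric_graph R).
Implicit Types (e : edge G) (r : \bar R -> curve G) (f : curve G -> \bar R).

Lemma near_pinfty_shift (P : R -> Prop) (c : R) :
  (\forall t \near +oo, P t) -> \forall t \near +oo, P (t + c).
Proof.
move=> [M [_ MP]]; exists (M - c); split; first exact: num_real.
by move=> t Mt; apply: MP; rewrite -ltrBlDr.
Qed.

Lemma ray_param_shift r : ray_param r -> exists e (c : R),
  [/\ len e = +oo%E, r +oo%E = param e +oo%E &
      forall t, Num.max 0 (- c) <= t -> r t%:E = param e (t + c)%:E].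
Proof.
move=> [G' [h [e' [hh le' ->]]]].
have [e [c [T [le T0 Tc TP]]]] := isometry_tail hh le'.
exists e, c; split=> //; last exact: (agree_max hh le' le T0 Tc TP).
have cv : edist e (h (param e' t%:E)) @[t --> +oo] -->
    edist e (h (param e' +oo%E)).
  apply: (@cvg_infty _ G' e' (fun x => edist e (h x))) => // x U.
  by move=> /(@edist_continuous _ _ e); case: hh => ch _ _ /ch.
suff dE : edist e (h (param e' +oo%E)) = +oo%E.
  by rewrite -[in RHS]dE; apply: edist_gt0 => //; rewrite dE.
apply: (cvg_unique _ cv); first exact: ereal_hausdorff.
apply/cvgeyPge => A; near=> t.
have tT : T <= t by near: t; apply: nbhs_pinfty_ge; exact: num_real.
rewrite TP // edist_param //; last first.
  by rewrite lee_fin (le_trans Tc) // lerD2r.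
rewrite lee_fin -lerBlDr.
by near: t; apply: nbhs_pinfty_ge; exact: num_real.
Unshelve. all: by end_near. Qed.

Lemma curve_isometry_id : curve_isometry (@id (curve G)).
Proof.
split; first by move=> x; exact: cvg_id.
  by exists id => // x; exact: cvg_id.
move=> e; exists [:: (`]-oo, +oo[, (e, false, 0))] => t t0 tl; split.
  by exists (`]-oo, +oo[, (e, false, 0)); rewrite ?mem_head // in_itv.
move=> p; rewrite mem_seq1 => /eqP -> _ /=.
by exists t; rewrite expr0 mul1r addr0.
Qed.

Lemma ray_param_edge e : len e = +oo%E -> ray_param (param e).
Proof. by move=> le; exists G, id, e; split=> //; exact: curve_isometry_id. Qed.

Definition edge_ray e (le : len e = +oo%E) : ray G :=
  exist _ (param e @` [set` `[0%E, +oo%E]])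
    (ex_intro2 _ _ (param e) (ray_param_edge le) erefl).

Lemma edge_ray_end e (le : len e = +oo%E) : sval (edge_ray le) (param e +oo%E).
Proof. by exists +oo%E => //=; rewrite in_itv /= leey. Qed.

Lemma ray_infty r e : ray_param r -> len e = +oo%E ->
  (r @` [set` `[0%E, +oo%E]]) (param e +oo%E) -> r +oo%E = param e +oo%E.
Proof.
move=> rp le [[t| |] //=]; rewrite in_itv /= => /andP[t0 _] rt.
by have [] := ray_param_finite rp t0; rewrite rt; exists e.
Qed.

Lemma ray_with_end r e : ray_param r -> len e = +oo%E ->
  (r @` [set` `[0%E, +oo%E]]) (param e +oo%E) -> exists c : R,
    forall t, Num.max 0 (- c) <= t -> r t%:E = param e (t + c)%:E.
Proof.
move=> rp le /(ray_infty rp le) rE.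
have [e1 [c [le1 r1 rc]]] := ray_param_shift rp.
have td : +oo%E \in edge_dom e by rewrite inE; exact: dom_infty.
by exists c; have [-> _] := param_eq_infty le1 td (etrans (esym rE) r1).
Qed.

Lemma ray_has_end (rho : ray G) :
  exists2 e, len e = +oo%E & sval rho (param e +oo%E).
Proof.
case: rho => _ /= [r rp ->]; have [e [c [le r1 _]]] := ray_param_shift rp.
by exists e => //; exists +oo%E; rewrite //= in_itv /= leey.
Qed.

(** With r t = param e (t + c), the sign of c tells which of the two segments
    starts closer to their common end. *)
Lemma ray_comparable (rho : ray G) e (le : len e = +oo%E) :
  sval rho (param e +oo%E) ->
  sval rho `<=` sval (edge_ray le) \/ sval (edge_ray le) `<=` sval rho.
Proof.
case: rho => _ /= [r rp ->] rho_e.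
have rE := ray_infty rp le rho_e.
have [c rc] := ray_with_end rp le rho_e.
have itvE (t : \bar R) : (t \in `[0%E, +oo%E]) = (0 <= t)%E.
  by rewrite in_itv /= leey andbT.
have [c0|c0] := leP 0 c; [left|right].
  move=> _ [t /= + <-]; rewrite itvE; case: t => [t t0| _|//].
    exists (t + c)%:E; first by rewrite /= itvE lee_fin addr_ge0.
    rewrite lee_fin in t0; rewrite rc // ge_max t0 /=.
    by apply: le_trans t0; rewrite oppr_le0.
  by rewrite rE; exists +oo%E => //=; rewrite itvE.
move=> _ [t /= + <-]; rewrite itvE; case: t => [t t0| _|//].
  exists (t - c)%:E.
    by rewrite /= itvE lee_fin subr_ge0 (le_trans (ltW c0)).
  rewrite rc ?subrK // ge_max subr_ge0 (le_trans (ltW c0)) //=.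
  by rewrite lerDr.
by rewrite -rE; exists +oo%E => //=; rewrite itvE.
Qed.

(** The slope at infinity along the edge itself, without quantification over
    the parametrizations of rays. *)
Definition end_slope f e (m : int) :=
  exists c : R, \forall t \near +oo, f (param e t%:E) = (m%:~R * t + c)%:E.

Lemma end_slope_uniq f e m m' : end_slope f e m -> end_slope f e m' -> m = m'.
Proof.
move=> [c [M [_ MP]]] [c' [M' [_ MP']]].
pose t := Num.max M M' + 1.
have [tM tM'] : M < t /\ M' < t.
  by rewrite /t; split; rewrite ltr_pwDr // le_max lexx ?orbT.
have [t1M t1M'] : M < t + 1 /\ M' < t + 1 by split; lra.
have [] : (m%:~R * t + c)%:E = (m'%:~R * t + c')%:E by rewrite -MP // MP'.
have [] : (m%:~R * (t + 1) + c)%:E = (m'%:~R * (t + 1) + c')%:E.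
  by rewrite -MP // MP'.
move=> h1 h2; have /eqP : (m%:~R : R) = m'%:~R by lra.
by rewrite eqr_int => /eqP.
Qed.

Lemma slope_at_inftyE f (rho : ray G) e m : len e = +oo%E ->
  sval rho (param e +oo%E) -> slope_at_infty f rho m <-> end_slope f e m.
Proof.
move=> le rho_e; split.
  case: rho rho_e => A [r rp AE] /= rho_e /(_ r rp AE)[c0 H].
  rewrite AE in rho_e; have [c rc] := ray_with_end rp le rho_e.
  exists (c0 - m%:~R * c); have {}H := near_pinfty_shift (- c) H.
  near=> t; have rt : r (t - c)%:E = param e t%:E.
    rewrite rc ?subrK // -lerBDr.
    by near: t; apply: nbhs_pinfty_ge; exact: num_real.
  rewrite -rt (near H t) //; congr _%:E; rewrite mulrBr.
  by lra.
move=> [c0 H] r rp rhoE; rewrite rhoE in rho_e.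
have [c rc] := ray_with_end rp le rho_e.
exists (m%:~R * c + c0); have {}H := near_pinfty_shift c H.
near=> t; rewrite rc; last first.
  by near: t; apply: nbhs_pinfty_ge; exact: num_real.
by rewrite (near H t) // mulrDr addrA.
Unshelve. all: by end_near. Qed.

Lemma rational_end_slope f e : rational f -> f <> cst -oo%E ->
  len e = +oo%E -> exists m, end_slope f e m.
Proof.
move=> [//|[_ _ /(_ e) pf]] _ le; rewrite le in pf.
by have [[m c] H] := piecewise_tail pf; exists m, c.
Qed.

Lemma cutdist_slope (N : edge G -> \bar R) e :
  (forall e, 0 <= N e)%E -> len e = +oo%E ->
  end_slope (cutdist N) e (if N e == +oo%E then 1 else 0).
Proof.
move=> N0 le; have cE (t : R) : 0 <= t ->
    cutdist N (param e t%:E) = mine t%:E (N e).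
  by move=> t0; rewrite cutdistE ?le ?eqxx //; apply: dom_infty.
case: eqP => [NE|NE].
  exists 0; near=> t.
  have t0 : 0 <= t by near: t; apply: nbhs_pinfty_ge; exact: num_real.
  by rewrite cE // NE min_l ?leey // mul1r addr0.
case NE' : (N e) => [n| |]; [exists n|by []|by have := N0 e; rewrite NE'].
near=> t; rewrite cE; last by near: t; apply: nbhs_pinfty_ge; exact: num_real.
rewrite NE' min_r ?mul0r ?add0r // lee_fin.
by near: t; apply: nbhs_pinfty_ge; exact: num_real.
Unshelve. all: by end_near. Qed.

End Rays.

Section ParallelEdges.
Variables (R : realType) (G : par_curve R).
Implicit Types (e : edge G) (u v : rat_par G).

(** Both rays are comparable, hence parallel, to the edge with this end. *)
Lemma same_end_parallel (rho rho' : ray G) e : len e = +oo%E ->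
  sval rho (param e +oo%E) -> sval rho' (param e +oo%E) -> parallel rho rho'.
Proof.
have [_ psym ptrans] := @parallel_equiv _ G.
move=> le; have pe (rho0 : ray G) : sval rho0 (param e +oo%E) ->
    parallel rho0 (edge_ray le).
  move=> /(ray_comparable le)[h|h]; first exact: parallel_sub.
  by apply: psym; exact: parallel_sub.
by move=> /pe h /pe h'; apply: (ptrans _ _ _ h); exact: psym.
Qed.

Definition parallel_edges e e' := exists rho rho' : ray G,
  [/\ parallel rho rho', sval rho (param e +oo%E) & sval rho' (param e' +oo%E)].

Lemma parallel_edges_refl e : len e = +oo%E -> parallel_edges e e.
Proof.
have [prefl _ _] := @parallel_equiv _ G.
move=> le; exists (edge_ray le), (edge_ray le).
by split=> //; exact: edge_ray_end.
Qed.

Lemma parallel_edges_sym e e' : parallel_edges e e' -> parallel_edges e' e.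
Proof.
have [_ psym _] := @parallel_equiv _ G.
by move=> [rho [rho' [h1 h2 h3]]]; exists rho', rho; split=> //; exact: psym.
Qed.

Lemma parallel_edges_trans e2 e1 e3 : len e2 = +oo%E ->
  parallel_edges e1 e2 -> parallel_edges e2 e3 -> parallel_edges e1 e3.
Proof.
have [_ _ ptrans] := @parallel_equiv _ G.
move=> le [r1 [r2 [h1 h2 h3]]] [r3 [r4 [h4 h5 h6]]]; exists r1, r4.
split=> //; apply: (ptrans _ _ _ h1); apply: (ptrans _ _ _ _ h4).
exact: same_end_parallel h3 h5.
Qed.

Lemma rat_par_neq0 u : u <> 0 -> (u : curve G -> \bar R) <> cst -oo%E.
Proof. by move=> u0 uE; apply: u0; apply: rat_par_eq => x _; rewrite uE. Qed.

Lemma parallel_end_slope u e e' m : u <> 0 -> len e = +oo%E ->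
  len e' = +oo%E -> parallel_edges e e' -> end_slope u e m -> end_slope u e' m.
Proof.
move=> u0 le le' [rho [rho' [par re re']]] um.
have [_ [/(rat_par_neq0 u0)//|/(_ _ _ par)[m' [um1 um2]]]] := rat_funP u.
apply/(slope_at_inftyE _ _ le' re').
suff -> : m = m' by [].
by apply: end_slope_uniq um _; apply/(slope_at_inftyE _ _ le re).
Qed.

(** The slope at infinity is 1 where the height is +oo and 0 elsewhere, so the
    set of edges of infinite height has to be a union of classes of parallel
    edges. *)
Lemma cutdist_rational_par (N : edge G -> \bar R) :
  (forall e, 0 <= N e)%E ->
  (forall e e', len e = +oo%E -> len e' = +oo%E -> parallel_edges e e' ->
     N e = +oo%E -> N e' = +oo%E) ->
  rational_par (cutdist N).
Proof.
move=> N0 Npar; split; first exact: cutdist_rational.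
right=> rho rho' par.
have [e le re] := ray_has_end rho; have [e' le' re'] := ray_has_end rho'.
have ee' : parallel_edges e e' by exists rho, rho'.
exists (if N e == +oo%E then 1 else 0); split.
  by apply/(slope_at_inftyE _ _ le re); exact: cutdist_slope.
apply/(slope_at_inftyE _ _ le' re').
have -> : (N e == +oo%E) = (N e' == +oo%E).
  by apply/eqP/eqP; apply: Npar => //; exact: parallel_edges_sym.
exact: cutdist_slope.
Qed.

End ParallelEdges.

(** * The semifield of rational functions *)

Section RatParOrder.
Variables (R : realType) (G : par_curve R).
Implicit Types (u v w : rat_par G) (x : curve G) (e : edge G).

Lemma rat_addxx u : u + u = u.
Proof. by apply: rat_par_eq => x _; exact: maxxx. Qed.

Lemma rat_nleP u v : nle u v <-> forall x, finite_pt x -> (u x <= v x)%E.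
Proof.
split=> [uv x _|uv].
  by rewrite -uv [X in (_ <= X)%E]rpaddE le_max lexx.
by apply: rat_par_eq => x /uv uvx; rewrite [LHS]rpaddE max_r.
Qed.

Lemma rat_fin_num u x : u <> 0 -> finite_pt x -> u x \is a fin_num.
Proof.
by move=> /rat_par_neq0 u0; case: (rat_funP u) => [[//|[_ + _] _]]; apply.
Qed.

Definition rat_cst (a : R) : rat_par G := tfin a *: 1.

Lemma rat_cstE a x : finite_pt x -> rat_cst a x = a%:E.
Proof. by move=> fx; rewrite [LHS]rpmulE // rpcstE /= adde0. Qed.

Lemma rat_oneE x : finite_pt x -> (1 : rat_par G) x = 0%E.
Proof. by []. Qed.

Lemma rat_expE u n x (r : R) : finite_pt x -> u x = r%:E ->
  (u ^+ n) x = (n%:R * r)%:E.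
Proof.
move=> fx ux; elim: n => [|n IH]; first by rewrite expr0 mul0r.
rewrite exprS [LHS]rpmulE // IH ux -EFinD; congr _%:E.
by rewrite -natr1 mulrDl mul1r addrC.
Qed.

Lemma rational_opp f : rational f -> f <> cst -oo%E ->
  rational (fun x : curve G => - f x)%E.
Proof.
move=> [//|[cf ff pf]] _; right; split.
- by move=> x; apply: (continuous_comp (cf x)); exact: oppe_continuous.
- by move=> x fx; rewrite fin_numN ff.
move=> e; have [s sP] := pf e.
exists [seq (p.1, (- p.2.1, - p.2.2)) | p <- s] => t t0 tl.
have [[p ps pt] H] := sP t t0 tl; split.
  by exists (p.1, (- p.2.1, - p.2.2)) => //; apply/mapP; exists p.
move=> _ /mapP[q qs ->] /= qt; rewrite (H q qs qt) -EFinN.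
by congr _%:E; rewrite opprD mulrNz mulNr.
Qed.

Lemma end_slope_opp (f : curve G -> \bar R) e m :
  end_slope f e m -> end_slope (fun x => - f x)%E e (- m).
Proof.
move=> [c H]; exists (- c); near=> t.
by rewrite (near H t) // -EFinN opprD mulrNz mulNr.
Unshelve. all: by end_near. Qed.

Lemma rat_inverse u : u <> 0 -> exists2 v, u * v = 1 &
  forall x, v x = (- u x)%E.
Proof.
move=> u0; have u0' := rat_par_neq0 u0.
have rv : rational_par (fun x : curve G => - u x)%E.
  have [ru [//|su]] := rat_funP u; split; first exact: rational_opp.
  right=> rho rho' par.
  have [e le re] := ray_has_end rho; have [e' le' re'] := ray_has_end rho'.
  have [m [um um']] := su _ _ par; exists (- m).
  by split; [apply/(slope_at_inftyE _ _ le re)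
            |apply/(slope_at_inftyE _ _ le' re')];
    apply: end_slope_opp;
    [apply/(slope_at_inftyE _ _ le re)|apply/(slope_at_inftyE _ _ le' re')].
exists (RatPar rv) => //; apply: rat_par_eq => x fx.
by rewrite [LHS]rpmulE //= subee // rat_fin_num.
Qed.

Lemma rat_mul_neq0 u v : u <> 0 -> v <> 0 -> u * v <> 0.
Proof.
move=> u0 /rat_inverse[w vw _] uv; apply: u0.
by rewrite -[u]mulr1 -vw mulrA uv mul0r.
Qed.

Lemma rat_cst_neq0 a : rat_cst a <> 0.
Proof.
move=> a0; have /card_gt0P[v _] := graph_nonempty G.
have /eqP := rpone_neq0 G; apply.
apply: rat_par_eq => x fx; have := rat_cstE a fx.
by rewrite a0.
Qed.

(** The second case contains the finite points that lie on no edge at all,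
    which occur for the graph with one vertex and no edge. *)
Lemma cutdist_cases x : finite_pt x ->
  (exists e (t : R), [/\ len e = +oo%E, 0 <= t, x = param e t%:E & forall N,
     (forall e, 0 <= N e)%E -> cutdist N x = mine t%:E (N e)]) \/
  (forall N, cutdist N x = 0%E).
Proof.
case: x => [v fx|p fx].
  right=> N /=; case: pickP => // e /andP[/eqP le /eqP ev]; exfalso; apply: fx.
  by exists e; rewrite // param_pinfty ev.
case: p fx => -[e t] /= h fx.
have [le|le] := eqVneq (len e) +oo%E; last by right.
case/andP: (h) => t0 _; left; exists e, t; split=> //; first exact: ltW.
rewrite /param leNgt lte_fin t0 /= insubT.
by congr inr; apply: val_inj.
Qed.

End RatParOrder.

Lemma ex_nat_ge (R : realType) (x : R) : exists n : nat, x <= n%:R.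
Proof.
exists (Num.bound `|x|); apply: (le_trans (ler_norm x)).
by apply: ltW; apply: archi_boundP; exact: normr_ge0.
Qed.

(** Asking for the property at all larger numbers replaces monotonicity of Q.
    *)
Lemma finite_uniform (I : finType) (Q : I -> nat -> Prop) :
  (forall i, exists n, forall n', (n <= n')%N -> Q i n') ->
  exists n, forall n' i, (n <= n')%N -> Q i n'.
Proof.
move=> /choice[F FP]; exists (\max_i F i)%N => n' i nn'.
by apply: FP; apply: leq_trans nn'; exact: leq_bigmax.
Qed.

(** * Linear growth of rational functions *)

Section Bound.
Variables (R : realType) (G : metric_graph R).
Variables (f : curve G -> \bar R) (A : pred (edge G)).
Hypothesis rf : rational f.
Hypothesis f0 : f <> cst -oo%E.
Hypothesis slopes : forall e m, len e = +oo%E -> ~~ A e ->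
  end_slope f e m -> m <= 0.

Let D := cutdist (fun e => if A e then +oo%E else 0%E).

Lemma class_cut_ge0 (e : edge G) : (0 <= (if A e then +oo else 0 : \bar R))%E.
Proof. by case: ifP. Qed.

Let bounded_by (n : nat) x :=
  exists y d : R, [/\ f x = y%:E, D x = d%:E & y <= n%:R + n%:R * d].

(** The finitely many affine pieces give a bound that is affine in t. It
    becomes a constant on an edge of finite length, and also on an infinite
    edge off A, where the last piece does not increase. *)
Lemma bounded_edge e : exists n, forall n', (n <= n')%N ->
  forall t : R, 0 <= t -> (t%:E <= len e)%E -> bounded_by n' (param e t%:E).
Proof.
have [//|[_ _ /(_ e)[s sP]]] := rf.
have [M MP] : exists M : nat, forall p, p \in s ->
    (p.2.1%:~R <= M%:R :> R) /\ p.2.2 <= M%:R.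
  elim: s {sP} => [|p s [M MP]]; first by exists 0%N.
  have [M1 M1P] := ex_nat_ge (p.2.1%:~R : R); have [M2 M2P] := ex_nat_ge p.2.2.
  exists (maxn M (maxn M1 M2)) => q; rewrite inE => /predU1P[->|/MP[h1 h2]].
    split; [apply: le_trans M1P _|apply: le_trans M2P _];
      by rewrite ler_nat !leq_max leqnn ?orbT.
  by split; [apply: le_trans h1 _|apply: le_trans h2 _];
    rewrite ler_nat leq_max leqnn.
have fP (t : R) : 0 <= t -> (t%:E <= len e)%E ->
    exists2 y, f (param e t%:E) = y%:E & y <= M%:R * t + M%:R.
  move=> t0 tl; have [[p ps pt] /(_ _ ps pt) fE] := sP t t0 tl.
  exists (p.2.1%:~R * t + p.2.2) => //; have [h1 h2] := MP _ ps.
  by rewrite lerD // ler_wpM2r.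
have DP (t : R) : 0 <= t -> (t%:E <= len e)%E -> D (param e t%:E) =
    (if (len e == +oo%E) && A e then t else 0)%:E.
  move=> t0 tl; rewrite /D cutdistE; [|exact: class_cut_ge0|]; last first.
    by rewrite /edge_dom /= lee_fin t0 tl.
  case: eqP => _ //=; case: ifP => _; first by rewrite min_l ?leey.
  by rewrite min_r ?lee_fin.
have [le|le] := eqVneq (len e) +oo%E; last first.
  have [l lE] : exists l, len e = l%:E.
    by case: (len e) (len_gt0 e) le => // l _ _; exists l.
  have [n nP] := ex_nat_ge (M%:R * l + M%:R); exists n => n' nn' t t0 tl.
  have [y yE yM] := fP t t0 tl; exists y, 0; split=> //.
    by rewrite DP // (negbTE le).
  rewrite mulr0 addr0 (le_trans yM) //; apply: le_trans (_ : n%:R <= _).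
    apply: le_trans nP; rewrite lerD2r ler_wpM2l //.
    by rewrite lE lee_fin in tl.
  by rewrite ler_nat.
have [Ae|Ae] := boolP (A e).
  exists M => n' Mn' t t0 tl; have [y yE yM] := fP t t0 tl; exists y, t.
  split=> //; first by rewrite DP // le Ae.
  apply: le_trans yM _; rewrite addrC.
  by apply: lerD; [|apply: ler_wpM2r => //]; rewrite ler_nat.
have [m [c [T [_ TP]]]] := rational_end_slope rf f0 le.
have m0 : m <= 0.
  apply: (slopes le Ae); exists c; exists T; split; first exact: num_real.
  exact: TP.
have [n1 n1P] := ex_nat_ge (M%:R * Num.max T 0 + M%:R).
have [n2 n2P] := ex_nat_ge c.
exists (maxn n1 n2) => n' nn' t t0 tl.
have [y yE yM] := fP t t0 tl; exists y, 0; split=> //.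
  by rewrite DP // (negbTE Ae) andbF.
move: nn'; rewrite geq_max -!(ler_nat R) => /andP[nn1 nn2].
rewrite mulr0 addr0; have [tT|tT] := leP t T.
  apply: le_trans nn1; apply: le_trans n1P; apply: le_trans yM _.
  by rewrite lerD2r ler_wpM2l // le_max tT.
apply: le_trans nn2; apply: le_trans n2P.
have [<-] : (m%:~R * t + c)%:E = y%:E by rewrite -yE TP.
by rewrite gerDr mulr_le0_ge0 // lerz0.
Qed.

Lemma rational_bound : exists n : nat, forall x, finite_pt x -> bounded_by n x.
Proof.
have [n1 n1P] := finite_uniform bounded_edge.
have vP (v : vertex G) : exists n, forall n', (n <= n')%N ->
    finite_pt (inl v : curve G) -> bounded_by n' (inl v).
  have [fv|] := pselect (finite_pt (inl v : curve G)); last by exists 0%N.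
  have [//|[_ ff _]] := rf; have fvE := fineK (ff _ fv).
  have [n nP] := ex_nat_ge (fine (f (inl v))); exists n => n' nn' _.
  have dvE := fineK (cutdist_finite class_cut_ge0 fv).
  exists (fine (f (inl v))), (fine (D (inl v))); split=> //.
  apply: le_trans nP _; rewrite -(ler_nat R) in nn'; apply: le_trans nn' _.
  rewrite lerDl mulr_ge0 // fine_ge0 //; exact: (cutdist_ge0 _ class_cut_ge0).
have [n2 n2P] := finite_uniform vP.
exists (maxn n1 n2) => -[v|p] fx; first by apply: n2P => //; rewrite leq_maxr.
case: p fx => -[e t] /= h fx; case/andP: (h) => t0 tl.
have := n1P (maxn n1 n2) e (leq_maxl _ _) t (ltW t0) (ltW tl).
rewrite /param leNgt lte_fin t0 /= insubT.
by congr (bounded_by _ (inr _)); exact: val_inj.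
Qed.

End Bound.

(** * Distances along classes of parallel edges *)

Section CutFunctions.
Variables (R : realType) (G : par_curve R).
Implicit Types (u v w : rat_par G) (x : curve G) (e : edge G).

Lemma dist_subproof : rational_par (cutdist (fun _ : edge G => +oo%E)).
Proof. by apply: cutdist_rational_par => // e; rewrite leey. Qed.

Lemma edges_cut_subproof (A : pred (edge G)) (c : R) : 0 <= c ->
  rational_par (cutdist (fun e => if A e then c%:E else 0%E)).
Proof.
move=> c0; apply: cutdist_rational_par; first by move=> e; case: ifP.
by move=> e e' _ _ _; case: ifP.
Qed.

Definition in_class e (e' : edge G) := `[< parallel_edges e e' >].

Lemma class_dist_subproof e (b : bool) : len e = +oo%E ->
  rational_par (cutdist (fun e' => if in_class e e' == b then +oo%E else 0%E)).
Proof.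
move=> le; apply: cutdist_rational_par; first by move=> e'; case: ifP.
move=> e1 e2 le1 le2 par12.
have -> : in_class e e1 = in_class e e2.
  apply/asboolP/asboolP => h; first exact: parallel_edges_trans h par12.
  exact: parallel_edges_trans h (parallel_edges_sym par12).
by [].
Qed.

Definition dist : rat_par G := RatPar dist_subproof.
Definition edges_cut (A : pred (edge G)) (c : R) (c0 : 0 <= c) : rat_par G :=
  RatPar (edges_cut_subproof A c0).
(** The distance along the edges parallel to e (b = true), or along all the
    others (b = false). *)
Definition class_dist e (le : len e = +oo%E) (b : bool) : rat_par G :=
  RatPar (class_dist_subproof b le).

Lemma edges_cutE A c (c0 : 0 <= c) e (t : R) : len e = +oo%E -> 0 <= t ->
  edges_cut A c0 (param e t%:E) = (if A e then Num.min t c else 0)%:E.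
Proof.
move=> le t0; rewrite [LHS]cutdistE; last exact: dom_infty.
  rewrite le eqxx; case: ifP => _; first by rewrite EFin_min.
  by rewrite min_r.
by move=> e'; case: ifP.
Qed.

Lemma class_distE e (le : len e = +oo%E) b e' (t : R) :
  len e' = +oo%E -> 0 <= t ->
  class_dist le b (param e' t%:E) = (if in_class e e' == b then t else 0)%:E.
Proof.
move=> le' t0; rewrite [LHS]cutdistE; last exact: dom_infty.
  rewrite le' eqxx; case: ifP => _; first by rewrite min_l ?leey.
  by rewrite min_r.
by move=> e''; case: ifP.
Qed.

Lemma distE e (t : R) : len e = +oo%E -> 0 <= t -> dist (param e t%:E) = t%:E.
Proof.
move=> le t0; rewrite [LHS]cutdistE; last exact: dom_infty.
  by rewrite le eqxx min_l ?leey.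
by move=> e'; rewrite leey.
Qed.

Lemma finite_pt_cut_ind (P : curve G -> Prop) :
  (forall e (t : R), len e = +oo%E -> 0 <= t -> finite_pt (param e t%:E) ->
     P (param e t%:E)) ->
  (forall x, finite_pt x -> (forall N, cutdist N x = 0%E) -> P x) ->
  forall x, finite_pt x -> P x.
Proof.
move=> H1 H2 x fx.
have [[e [t [le t0 xE _]]]|x0] := cutdist_cases fx; last exact: H2.
by subst x; apply: H1.
Qed.

Lemma in_class_refl e : len e = +oo%E -> in_class e e.
Proof. by move=> le; apply/asboolP; exact: parallel_edges_refl. Qed.

Lemma rat_cstM a b : rat_cst G a * rat_cst G b = rat_cst G (a + b).
Proof.
by apply: rat_par_eq => x fx; rewrite [LHS]rpmulE // !rat_cstE.
Qed.

Lemma rat_cst0 : rat_cst G 0 = 1.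
Proof. by apply: rat_par_eq => x fx; rewrite rat_cstE // rat_oneE. Qed.

Lemma rat_cstX a n : rat_cst G a ^+ n = rat_cst G (n%:R * a).
Proof.
apply: rat_par_eq => x fx; rewrite rat_cstE //.
by apply: rat_expE => //; exact: rat_cstE.
Qed.

Lemma rat_cst_le a b : a <= b -> nle (rat_cst G a) (rat_cst G b).
Proof. by move=> ab; apply/rat_nleP => x fx; rewrite !rat_cstE // lee_fin. Qed.

Lemma one_le_cut A c (c0 : 0 <= c) : nle 1 (edges_cut A c0).
Proof.
apply/rat_nleP; apply: finite_pt_cut_ind => [e t le t0 fx|x fx x0].
  rewrite rat_oneE // edges_cutE // lee_fin; case: ifP => // _.
  by rewrite le_min t0.
by rewrite rat_oneE // [X in (_ <= X)%E]x0.
Qed.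

Lemma one_le_class e (le : len e = +oo%E) b : nle 1 (class_dist le b).
Proof.
apply/rat_nleP; apply: finite_pt_cut_ind => [e' t le' t0 fx|x fx x0].
  by rewrite rat_oneE // class_distE // lee_fin; case: ifP.
by rewrite rat_oneE // [X in (_ <= X)%E]x0.
Qed.

(** On real values this is the identity min(d, c) + max(d, c) = d + c. *)
Lemma cut_mul_max c (c0 : 0 <= c) :
  edges_cut predT c0 * (dist + rat_cst G c) = dist * rat_cst G c.
Proof.
apply: rat_par_eq; apply: finite_pt_cut_ind => [e t le t0 fx|x fx x0];
  rewrite [LHS]rpmulE // [RHS]rpmulE // [(dist + _) _]rpaddE rat_cstE //.
  rewrite distE // edges_cutE //= -EFin_max -!EFinD; congr _%:E.
  by rewrite addr_min_max.
by rewrite [edges_cut _ _ _]x0 [dist _]x0 max_r ?lee_fin.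
Qed.

Lemma edges_cut_split A c (c0 : 0 <= c) :
  edges_cut A c0 * edges_cut (predC A) c0 = edges_cut predT c0.
Proof.
apply: rat_par_eq; apply: finite_pt_cut_ind => [e t le t0 fx|x fx x0];
  rewrite [LHS]rpmulE //.
  rewrite !edges_cutE //=.
  by case: (A e) => /=; rewrite -EFinD ?addr0 ?add0r.
by rewrite ![edges_cut _ _ _]x0 adde0.
Qed.

(** Where at least one of two nonnegative functions vanishes, their sum is
    their maximum. *)
Lemma edges_cut_disjoint A c (c0 : 0 <= c) :
  edges_cut A c0 * edges_cut (predC A) c0 =
  edges_cut A c0 + edges_cut (predC A) c0.
Proof.
apply: rat_par_eq; apply: finite_pt_cut_ind => [e t le t0 fx|x fx x0];
  rewrite [LHS]rpmulE // [RHS]rpaddE.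
  have m0 : 0 <= Num.min t c by rewrite le_min t0.
  rewrite !edges_cutE //=; case: (A e) => /=.
    by rewrite -EFinD -EFin_max addr0 max_l.
  by rewrite -EFinD -EFin_max add0r max_r.
by rewrite ![edges_cut _ _ _]x0 adde0 maxxx.
Qed.

Lemma class_dist_disjoint e (le : len e = +oo%E) :
  class_dist le true * class_dist le false =
  class_dist le true + class_dist le false.
Proof.
apply: rat_par_eq; apply: finite_pt_cut_ind => [e' t le' t0 fx|x fx x0];
  rewrite [LHS]rpmulE // [RHS]rpaddE.
  rewrite !class_distE //=; case: (in_class e e') => /=.
    by rewrite -EFinD -EFin_max addr0 max_l.
  by rewrite -EFinD -EFin_max add0r max_r.
by rewrite ![class_dist _ _ _]x0 adde0 maxxx.
Qed.

Lemma cut_le_sum c (c0 : 0 <= c) :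
  nle (edges_cut predT c0)
      (1 + \sum_(e | len e == +oo%E) edges_cut (pred1 e) c0).
Proof.
apply/rat_nleP; apply: finite_pt_cut_ind => [e t le t0 fx|x fx x0].
  apply: le_trans (_ : (edges_cut (pred1 e) c0 (param e t%:E) <= _)%E).
    by rewrite !edges_cutE //= eqxx.
  have /rat_nleP : nle (edges_cut (pred1 e) c0)
      (1 + \sum_(e | len e == +oo%E) edges_cut (pred1 e) c0).
    rewrite (bigD1 e) /= ?le ?eqxx // addrCA; exact/nle_addl/rat_addxx.
  by apply.
rewrite [X in (X <= _)%E]x0 -(rat_oneE fx).
have /rat_nleP : nle (1 : rat_par G)
    (1 + \sum_(e | len e == +oo%E) edges_cut (pred1 e) c0).
  exact/nle_addl/rat_addxx.
by apply.
Qed.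

Lemma cut_le_cut e c c' (c0 : 0 <= c) (c0' : 0 <= c') : c <= c' ->
  nle (edges_cut (pred1 e) c0) (edges_cut (pred1 e) c0').
Proof.
move=> cc'; apply/rat_nleP; apply: finite_pt_cut_ind => [e' t le t0 fx|x fx x0].
  rewrite !edges_cutE //= lee_fin; case: ifP => // _.
  by rewrite le_min !ge_min lexx cc' orbT.
by rewrite ![edges_cut _ _ _]x0.
Qed.

Lemma cut_le_class e (le : len e = +oo%E) c (c0 : 0 <= c) :
  nle (edges_cut (pred1 e) c0) (class_dist le true).
Proof.
apply/rat_nleP; apply: finite_pt_cut_ind => [e' t le' t0 fx|x fx x0].
  rewrite edges_cutE // class_distE //= lee_fin.
  case: eqP => [->|_]; first by rewrite in_class_refl //= ge_min lexx.
  by case: ifP.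
by rewrite [edges_cut _ _ _]x0 [class_dist _ _ _]x0.
Qed.

Lemma rat_bound_dist u : u <> 0 ->
  exists n : nat, nle u (rat_cst G n%:R * dist ^+ n).
Proof.
move=> u0; have [ru _] := rat_funP u.
have [//|n nP] := @rational_bound _ _ u predT ru (rat_par_neq0 u0).
exists n; apply/rat_nleP => x fx; have [y [d [uE dE yd]]] := nP x fx.
have {}dE : dist x = d%:E by exact: dE.
by rewrite uE rpmulE // rat_cstE // (rat_expE n fx dE) -EFinD lee_fin.
Qed.

(** Parallel edges share the slope of u, so u can only grow along the other
    classes. *)
Lemma rat_bound_class u e (le : len e = +oo%E) : u <> 0 ->
  (forall m, end_slope u e m -> m <= 0) ->
  exists n : nat, nle u (rat_cst G n%:R * class_dist le false ^+ n).
Proof.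
move=> u0 um; have [ru _] := rat_funP u.
have [|n nP] := @rational_bound _ _ u (fun e' => in_class e e' == false) ru
    (rat_par_neq0 u0).
  move=> e' m le'; rewrite eqbF_neg negbK => /asboolP ee' ue'.
  apply: um; apply: parallel_end_slope ue' => //; exact: parallel_edges_sym.
exists n; apply/rat_nleP => x fx; have [y [d [uE dE yd]]] := nP x fx.
have {}dE : class_dist le false x = d%:E by exact: dE.
by rewrite uE rpmulE // rat_cstE // (rat_expE n fx dE) -EFinD lee_fin.
Qed.

End CutFunctions.

(** * Primes of type I-2 are germs at points at infinity *)

Section PointAtInfinity.
Variables (R : realType) (G : par_curve R).
Implicit Types (u v w : rat_par G) (e : edge G).

(** A neighborhood of the point also contains the point itself, where equality
    follows by continuity. *)
Lemma phi_inftyP e u v : len e = +oo%E ->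
  phi (param e +oo%E) (u, v) <->
  \forall t \near +oo, u (param e t%:E) = v (param e t%:E).
Proof.
move=> le; have inf : infty_pt (param e +oo%E) by exists e.
rewrite /phi; case: asboolP => [[]//|_] /=; split.
  by move/(nbhs_infty _ le) => [].
move=> H; apply/(nbhs_infty _ le); split=> //=.
have cu := cvg_infty le (rational_continuous (rat_funP u).1).
have cv := cvg_infty le (rational_continuous (rat_funP v).1).
apply: (cvg_unique _ cu); first exact: ereal_hausdorff.
apply: cvg_trans cv; apply: near_eq_cvg.
by apply: filterS H => t ->.
Qed.

Lemma rat_end_slope u e : u <> 0 -> len e = +oo%E -> exists m, end_slope u e m.
Proof.
move=> u0; apply: rational_end_slope; first exact: (rat_funP u).1.
exact: rat_par_neq0.
Qed.

Lemma end_finite_pt e : len e = +oo%E ->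
  \forall t \near +oo, finite_pt (param e t%:E).
Proof.
move=> le; near=> t; apply: finite_param; last by rewrite le leey.
by near: t; apply: nbhs_pinfty_ge; exact: num_real.
Unshelve. all: by end_near. Qed.

End PointAtInfinity.

Section Classification.
Variables (R : realType) (G : par_curve R) (P : congruence (rat_par G)).
Hypothesis primeP : prime_congruence P.
Hypothesis cst_inj : injective (fun a : R => tfin a *: (1 : quot P)).
Hypothesis unbounded :
  exists u : quot P, forall a : R, nle (tfin a *: (1 : quot P)) u.
Implicit Types (u v w : rat_par G) (e : edge G).

Let q := qpi P.
Let c (a : R) := q (rat_cst G a).
Let qxx : forall u : quot P, u + u = u := quot_addxx (@rat_addxx _ G).

Lemma quot_nle u v : nle u v -> nle (q u) (q v).
Proof. by rewrite /nle /q -qpiD => ->. Qed.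

Lemma quot_cst_le a b : nle (c a) (c b) -> a <= b.
Proof.
move=> ab; rewrite leNgt; apply/negP => ba.
suff ab' : a = b by rewrite ab' ltxx in ba.
apply: cst_inj; rewrite /= -(qpiZ P) -/(rat_cst G a) -(qpiZ P) -/(rat_cst G b).
by apply: nle_anti ab _; apply: quot_nle; apply: rat_cst_le; exact: ltW.
Qed.

Let c0 : c 0 = 1. Proof. by rewrite /c rat_cst0. Qed.

Let qM u v : q (u * v) = q u * q v. Proof. exact: qpiM. Qed.

Lemma quot_neq0 u : u <> 0 -> q u != 0.
Proof.
move=> /rat_inverse[v uv _]; apply/eqP => qu0.
have := quot_one_neq0 primeP; rewrite -[1]/(q 1) -uv qM qu0 mul0r.
by rewrite eqxx.
Qed.

Lemma quot_neq0_ge1 u : nle 1 (q u) -> q u != 0.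
Proof.
move=> u1; apply/eqP => u0; have := quot_one_neq0 primeP.
by move: u1; rewrite /nle u0 addr0 => ->; rewrite eqxx.
Qed.

(** Otherwise dist is below a constant modulo P, and by linear growth so is
    every function, against the existence of a class above all constants. *)
Lemma quot_cst_le_dist a : nle (c a) (q (dist G)).
Proof.
have [w] := unbounded; elim/qpi_ind: w => u cu.
have {}cu b : nle (c b) (q u) by rewrite /c /q qpiZ; exact: cu.
have u0 : u <> 0.
  move=> u0; have := quot_neq0_ge1 (u := u); rewrite -c0 => /(_ (cu 0)).
  by rewrite u0 eqxx.
have [n un] := rat_bound_dist u0.
have [//|da] := quot_total (@rat_addxx _ G) primeP (c a) (q (dist G)).
have h : nle (c (n%:R + n%:R * a + 1)) (c (n%:R + n%:R * a)).
  apply: nle_trans (cu _) _; apply: nle_trans (quot_nle un) _.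
  rewrite /c -rat_cstM -rat_cstX !qM /q !(qpiX P).
  by apply: nleM; [exact: nle_refl qxx _|exact: (nleX qxx _ da)].
have := quot_cst_le h; lra.
Qed.

(** Modulo P the maximum of dist and a is dist, which can be cancelled in the
    identity of [cut_mul_max]. *)
Lemma quot_cut_all (a : R) (a0 : 0 <= a) : q (@edges_cut _ G predT _ a0) = c a.
Proof.
have d1 : nle 1 (q (dist G)) by rewrite -c0; exact: quot_cst_le_dist.
apply: (quot_mulIr primeP (quot_neq0_ge1 d1)).
rewrite -qM [RHS]mulrC -qM -cut_mul_max !qM; congr (_ * _).
by rewrite /q qpiD addrC; apply: esym; exact: quot_cst_le_dist.
Qed.

(** In the totally ordered quotient u + v is u or v; cancelling it from u * v
    leaves v = 1 or u = 1. *)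
Lemma quot_disjoint u v : nle 1 u -> nle 1 v -> u * v = u + v ->
  q u <> 1 -> q v = 1.
Proof.
move=> /quot_nle u1 /quot_nle v1 uv uN1.
have quv : q u * q v = q u + q v by rewrite -qM uv [LHS]qpiD.
have [h|h] := quot_total (@rat_addxx _ G) primeP (q u) (q v).
  exfalso; apply: uN1; apply: (quot_mulIr primeP (quot_neq0_ge1 v1)).
  by rewrite mul1r -[RHS]h.
apply: (quot_mulIr primeP (quot_neq0_ge1 u1)).
by rewrite mul1r mulrC quv addrC.
Qed.

Lemma quot_neq1_mono u v : nle 1 u -> nle u v -> q u <> 1 -> q v <> 1.
Proof.
move=> u1 uv uN1 v1; apply: uN1; apply: nle_anti (quot_nle u1).
by rewrite -[X in nle _ X]v1; exact: quot_nle.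
Qed.

(** The pieces of the cut distance cannot all be trivial: their maximum has the
    class of the real constant 1, which differs from that of 0. The end of such
    an edge will be the center of P. *)
Lemma exists_center_end : exists2 e, len e = +oo%E &
  q (edges_cut (pred1 e) ler01) <> 1.
Proof.
apply: contrapT => H.
have H1 e : len e == +oo%E -> q (edges_cut (pred1 e) ler01) = 1.
  by move=> /eqP le; apply: contrapT => h; apply: H; exists e.
have : nle (c 1) (c 0).
  rewrite -(quot_cut_all ler01) c0.
  apply: nle_trans (quot_nle (cut_le_sum G ler01)) _.
  rewrite /q qpiD qpi_sum /nle [1 + _]addrC -addrA.
  rewrite [X in _ + X](_ : _ = 1); last exact: qxx.
  elim/big_ind : _ => [|x y hx hy|e /H1 h]; first by rewrite add0r.
    by rewrite -addrA hy.
  by rewrite [qpi P _]h qxx.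
by move/quot_cst_le; rewrite ler10.
Qed.

Section End.
Variable e : edge G.
Hypothesis le : len e = +oo%E.
Hypothesis eN1 : q (edges_cut (pred1 e) ler01) <> 1.

Lemma quot_cut_end (a : R) (a0 : 0 <= a) : 1 <= a ->
  q (edges_cut (pred1 e) a0) = c a.
Proof.
move=> a1; have rest1 : q (edges_cut (predC (pred1 e)) a0) = 1.
  apply: quot_disjoint (edges_cut_disjoint _ _) _; try exact: one_le_cut.
  by apply: quot_neq1_mono eN1; [exact: one_le_cut|exact: cut_le_cut].
by rewrite -(quot_cut_all a0) -(edges_cut_split (pred1 e)) qM rest1 mulr1.
Qed.

Lemma quot_other_classes : q (class_dist le false) = 1.
Proof.
apply: quot_disjoint (class_dist_disjoint le) _; try exact: one_le_class.
by apply: quot_neq1_mono eN1; [exact: one_le_cut|exact: cut_le_class].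
Qed.

(** On e, the sum of u and the piece of height N is at most N: beyond M because
    u <= 0 there, and before M because the piece is still below M while u is
    bounded. Elsewhere u is at most a constant plus a multiple of the distance
    along the other classes, which is trivial modulo P. As the piece has the
    class of N, it can be cancelled. *)
Lemma quot_le1_near u : u <> 0 ->
  (\forall t \near +oo, (u (param e t%:E) <= 0)%E) -> nle (q u) 1.
Proof.
move=> u0 [M [_ MP]].
have um m : end_slope u e m -> m <= 0.
  move=> [b [M' [_ MP']]]; rewrite leNgt; apply/negP => m0.
  (* a positive slope makes u positive at a far point of e *)
  pose t := Num.max (Num.max M M') (Num.max 0 (- b)) + 1.
  have [tM tM' t0 tb] : [/\ M < t, M' < t, 0 < t & - b < t].
    by split; rewrite ltr_pwDr // !le_max lexx ?orbT.
  have := MP t tM; rewrite MP' // lee_fin.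
  have m1 : 1 <= m%:~R :> R by rewrite -[1]/(1%:~R) ler_int.
  by nra.
have [n un] := rat_bound_class le u0 um.
pose N : R := Num.max M 0 + n%:R + 1.
have [N0 N1 Nn NM] : [/\ 0 <= N, 1 <= N, n%:R <= N & M + n%:R <= N].
  have := le_max 0 M 0; have := le_max M M 0; rewrite !lexx orbT /= /N.
  by have : 0 <= n%:R :> R by []; set x := Num.max M 0 => *; split; lra.
have key : nle (u * edges_cut (pred1 e) N0)
    (rat_cst G N * class_dist le false ^+ n).
  apply/rat_nleP; apply: finite_pt_cut_ind => [e' t le' t0 fx|x fx x0].
    have dE := class_distE le false le' t0.
    have := un; move=> /rat_nleP/(_ _ fx).
    rewrite (rpmulE u _ fx) !(rpmulE (rat_cst _ _) _ fx) !rat_cstE //.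
    rewrite (rat_expE n fx dE) edges_cutE //=.
    have [y uy] : exists y, u (param e' t%:E) = y%:E.
      by exists (fine (u (param e' t%:E))); rewrite fineK // rat_fin_num.
    rewrite uy -!EFinD !lee_fin.
    case: (e' =P e) => [ee|_].
      rewrite ee in_class_refl //= mulr0 !addr0 => h.
      have [tM|tM] := leP t M.
        have : Num.min t N <= t by rewrite ge_min lexx.
        by lra.
      have : Num.min t N <= N by rewrite ge_min lexx orbT.
      by have := MP t tM; rewrite -ee uy lee_fin; lra.
    by rewrite addr0 => h; apply: le_trans h _; rewrite lerD2r; lra.
  have := un; move=> /rat_nleP/(_ _ fx).
  have dE : class_dist le false x = 0%:E by exact: x0.
  rewrite (rpmulE u _ fx) !(rpmulE (rat_cst _ _) _ fx) !rat_cstE //.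
  rewrite (rat_expE n fx dE) [edges_cut _ _ _]x0 adde0 => h.
  apply: le_trans h _.
  by rewrite mulr0 -!EFinD lee_fin lerD2r; lra.
have qX : q (class_dist le false ^+ n) = 1.
  by rewrite [LHS](qpiX P) [qpi P _]quot_other_classes expr1n.
have := quot_nle key.
rewrite (qM u) (qM (rat_cst G N)) quot_cut_end // qX mulr1 => h.
have cc : c N * c (- N) = 1 by rewrite /c -qM rat_cstM subrr rat_cst0.
have {}h : nle (q u * c N) (c N) by exact: h.
by have := nleMr (c (- N)) h; rewrite -mulrA cc mulr1.
Qed.

Lemma quot_le_near u v : u <> 0 -> v <> 0 ->
  (\forall t \near +oo, (u (param e t%:E) <= v (param e t%:E))%E) ->
  nle (q u) (q v).
Proof.
move=> u0 v0 uv; have [w vw wE] := rat_inverse v0.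
have w0 : w <> 0.
  by move=> w0; have /eqP := rpone_neq0 G; apply; rewrite -[LHS]vw w0 mulr0.
have uw0 : u * w <> 0.
  move=> uw; apply: u0.
  by rewrite -[u]mulr1 -vw [v * w]mulrC mulrA uw mul0r.
have : nle (q (u * w)) 1.
  apply: quot_le1_near => //; near=> t.
  have ft : finite_pt (param e t%:E) by near: t; exact: end_finite_pt.
  rewrite rpmulE // wE leeBlDr ?add0e; last exact: rat_fin_num.
  by near: t.
move=> /(nleMr (q v)); rewrite mul1r -qM -mulrA [w * v]mulrC vw mulr1.
by [].
Unshelve. all: by end_near. Qed.

Lemma quot_neq_gap u v (d : R) : u <> 0 -> v <> 0 -> 0 < d ->
  (\forall t \near +oo, (v (param e t%:E) + d%:E <= u (param e t%:E))%E) ->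
  q u <> q v.
Proof.
move=> u0 v0 d0 uv quv; suff /quot_cst_le : nle (c d) (c 0) by rewrite leNgt d0.
have [w vw _] := rat_inverse v0.
have : nle (q (rat_cst G d * v)) (q u).
  apply: quot_le_near => //.
    by apply: rat_mul_neq0 => //; exact: rat_cst_neq0.
  near=> t; have ft : finite_pt (param e t%:E) by near: t; exact: end_finite_pt.
  rewrite rpmulE // rat_cstE // addeC.
  by near: t.
rewrite quv => /(nleMr (q w)); rewrite -(qM v) vw -(qM (rat_cst G d * v)).
by rewrite -mulrA vw mulr1 c0.
Unshelve. all: by end_near. Qed.

(** The germ of a function is a pair of a slope and a constant, and germs are
    compared lexicographically; a strict inequality leaves a gap of constant
    size. *)
Lemma quot_neq_lex u v (m m' : int) (b b' : R) : u <> 0 -> v <> 0 ->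
  (\forall t \near +oo, u (param e t%:E) = (m%:~R * t + b)%:E) ->
  (\forall t \near +oo, v (param e t%:E) = (m'%:~R * t + b')%:E) ->
  m < m' \/ m = m' /\ b < b' -> q v <> q u.
Proof.
move=> u0 v0 uE vE [mm'|[mm' bb']].
  apply: (quot_neq_gap (d := 1)) => //; near=> t.
  rewrite (near uE t) // (near vE t) // -EFinD lee_fin.
  have d1 : 1 <= m'%:~R - m%:~R :> R.
    by rewrite lerBrDl -[1]/(1%:~R) -intrD ler_int addrC lez1D.
  have tt : Num.max 0 (b + 1 - b') <= t.
    by near: t; apply: nbhs_pinfty_ge; exact: num_real.
  move: tt; rewrite ge_max => /andP[t0 tb].
  by nra.
apply: (quot_neq_gap (d := b' - b)) => //; first by rewrite subr_gt0.
near=> t; rewrite (near uE t) // (near vE t) // -EFinD lee_fin mm'; lra.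
Unshelve. all: by end_near. Qed.

Lemma near_eq_zero u v : u = 0 ->
  (\forall t \near +oo, u (param e t%:E) = v (param e t%:E)) -> v = 0.
Proof.
move=> u0 uv; apply: contrapT => v0; near (+oo : set_system R) => t.
have ft : finite_pt (param e t%:E) by near: t; exact: end_finite_pt.
have := rat_fin_num v0 ft; rewrite -(near uv t) // u0.
by [].
Unshelve. all: by end_near. Qed.

(** Equal germs are compared by <= in both directions; different germs are
    compared lexicographically and stay different modulo P. *)
Lemma phi_center_end : phi (param e +oo%E) = P.
Proof.
apply/seteqP; split=> -[u v].
  move=> /(phi_inftyP _ _ le) uv; apply/qpiP.
  have vu : \forall t \near +oo, v (param e t%:E) = u (param e t%:E).
    by apply: filterS uv.
  have [u0|u0] := pselect (u = 0); first by rewrite u0 (near_eq_zero u0 uv).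
  have v0 : v <> 0 by move=> v0; apply: u0; exact: near_eq_zero vu.
  by apply: nle_anti; apply: quot_le_near => //;
    [apply: filterS uv|apply: filterS vu] => t ->.
move=> /qpiP quv; apply/(phi_inftyP _ _ le).
have [u0|u0] := pselect (u = 0).
  have [->|/quot_neq0] := pselect (v = 0); first by rewrite u0; near=> t.
  by rewrite -[q v]quv u0 [qpi _ _](_ : _ = 0) ?eqxx.
have v0 : v <> 0.
  move=> v0; have := quot_neq0 u0; rewrite [q u]quv v0.
  by rewrite [qpi _ _](_ : _ = 0) ?eqxx.
have [m [b uE]] := rat_end_slope u0 le.
have [m' [b' vE]] := rat_end_slope v0 le.
have [mm'|mm'|mm'] := ltgtP m m'.
- by case: (quot_neq_lex u0 v0 uE vE) => //; left.
- by case: (quot_neq_lex v0 u0 vE uE) => //; left.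
have [bb'|bb'|bb'] := ltgtP b b'.
- by case: (quot_neq_lex u0 v0 uE vE) => //; right.
- by case: (quot_neq_lex v0 u0 vE uE) => //; right.
by apply: filterS2 uE vE => t -> ->; rewrite mm' bb'.
Unshelve. all: by end_near. Qed.

End End.

End Classification.

Lemma type_I2_phi (R : realType) (G : par_curve R)
    (P : congruence (rat_par G)) :
  type_I2 P -> exists2 e : edge G, len e = +oo%E & phi (param e +oo%E) = P.
Proof.
move=> hP; have [e le eN1] :=
  exists_center_end hP.1 (type_I2_cst_inj hP) (type_I2_unbounded hP).
exists e => //; apply: (phi_center_end _ _ _ _ eN1) => //.
- exact: hP.1.
- exact: type_I2_cst_inj.
- exact: type_I2_unbounded.
Qed.

(** * Slopes at infinity and primes of type I-1 *)

Section SlopeCongruence.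
Variables (R : realType) (G : par_curve R) (e : edge G).
Hypothesis le : len e = +oo%E.
Implicit Types u v : rat_par G.

(** The value at the function -oo, which has no slope, is the zero of T; this
    makes slope a morphism of semirings. *)
Definition slope u : trop R :=
  if pselect (exists m, end_slope u e m) is left h
  then tfin (projT1 (cid h))%:~R else 0.

Lemma slopeE u m : end_slope u e m -> slope u = tfin m%:~R.
Proof.
move=> um; rewrite /slope; case: pselect => [h|[]]; last by exists m.
by case: cid => m' um' /=; rewrite (end_slope_uniq um um').
Qed.

Lemma slope0 : slope 0 = 0.
Proof.
rewrite /slope; case: pselect => // -[m [c H]]; exfalso.
near (+oo : set_system R) => t.
by have : (0 : rat_par G) (param e t%:E) = (m%:~R * t + c)%:E by near: t.
Unshelve. all: by end_near. Qed.

Lemma slopeP u : u = 0 \/ exists m, end_slope u e m.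
Proof.
by have [|u0] := pselect (u = 0); [left|right; exact: rat_end_slope].
Qed.

Lemma slopeD u v : slope (u + v) = slope u + slope v.
Proof.
have [->|[m um]] := slopeP u; first by rewrite !add0r slope0 add0r.
have [->|[n vn]] := slopeP v; first by rewrite !addr0 slope0 addr0.
rewrite (slopeE um) (slopeE vn) tfinD.
have -> : Num.max m%:~R n%:~R = (Num.max m n)%:~R :> R.
  by rewrite !maxEle ler_int; case: ifP.
apply: slopeE.
apply/(slope_at_inftyE _ _ le (edge_ray_end le)).
by apply: slope_add; apply/(slope_at_inftyE _ _ le (edge_ray_end le)).
Qed.

Lemma slopeM u v : slope (u * v) = slope u * slope v.
Proof.
have [->|[m um]] := slopeP u; first by rewrite mul0r slope0 mul0r.
have [->|[n vn]] := slopeP v; first by rewrite mulr0 slope0 mulr0.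
rewrite (slopeE um) (slopeE vn) tfinM -intrD; apply: slopeE.
apply/(slope_at_inftyE _ _ le (edge_ray_end le)).
by apply: slope_mul; apply/(slope_at_inftyE _ _ le (edge_ray_end le)).
Qed.

Lemma slope_rat_cst a : slope (rat_cst G a) = 1.
Proof.
rewrite (@slopeE _ 0) //; exists a; near=> t.
rewrite mul0r add0r rat_cstE //.
by near: t; exact: end_finite_pt.
Unshelve. all: by end_near. Qed.

Lemma slope1 : slope 1 = 1.
Proof. by rewrite -rat_cst0 slope_rat_cst. Qed.

Lemma slope_nmod_morphism : nmod_morphism slope.
Proof. by split; [exact: slope0|exact: slopeD]. Qed.

Lemma slope_monoid_morphism : monoid_morphism slope.
Proof. by split; [exact: slope1|exact: slopeM]. Qed.

Definition slope_rmorph : {rmorphism rat_par G -> trop R} :=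
  HB.pack slope (GRing.isNmodMorphism.Build _ _ slope slope_nmod_morphism)
                (GRing.isMonoidMorphism.Build _ _ slope slope_monoid_morphism).

Lemma slopeX u n : slope (u ^+ n) = slope u ^+ n.
Proof. exact: (rmorphXn slope_rmorph). Qed.

(** Powers of the distance along the class of e, and of its inverse. *)
Lemma slope_onto m : exists u, slope u = tfin m%:~R.
Proof.
have D1 : end_slope (class_dist le true) e 1.
  exists 0; near=> t.
  have t0 : 0 <= t by near: t; apply: nbhs_pinfty_ge; exact: num_real.
  by rewrite class_distE // in_class_refl //= mul1r addr0.
have D0 : class_dist le true <> 0.
  by move=> D0; have := slopeE D1; rewrite D0 slope0.
have [v _ vE] := rat_inverse D0.
have v1 : end_slope v e (-1).
  have [c H] := end_slope_opp D1; exists c; near=> t.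
  by rewrite vE; near: t.
have expE (w : rat_par G) k (n : nat) : end_slope w e k ->
    slope (w ^+ n) = tfin (k *+ n)%:~R.
  move=> wk; rewrite slopeX (slopeE wk); elim: n => [|n IH]; first by [].
  by rewrite exprS IH tfinM mulrS intrD.
case: m => n.
  by exists (class_dist le true ^+ n); rewrite (expE _ _ _ D1) natz.
exists (v ^+ n.+1); rewrite (expE _ _ _ v1) NegzE.
by rewrite mulNrn natz.
Unshelve. all: by end_near. Qed.

Lemma slopeZ k u : slope (k *: u) = triv k * slope u.
Proof.
have -> : slope (k *: u) = slope (k *: 1) * slope u.
  by rewrite -slopeM -scalerAl mul1r.
congr (_ * _); have [->|[a ->]] := tropP k; first by rewrite scale0r slope0.
exact: slope_rat_cst.
Qed.

Lemma tdegZ k (f : laurent (trop R)) : tdeg (k *: f) = triv k * tdeg f.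
Proof.
rewrite [k *: f](_ : _ = lmono k 0 * f) // rmorphM; congr (_ * _).
by rewrite [LHS]leval_mono texp0 mulr1.
Qed.

(** The slope on K and the degree of Laurent polynomials have the same image,
    the integers and -oo, and both ignore nonzero scalars. *)
Lemma slope_type_I1 : type_I1 (ker_congruence slope_rmorph).
Proof.
split.
  split.
    move=> kerT; have : congr_set (ker_congruence slope_rmorph) (1, 0).
      by rewrite kerT.
    by rewrite /= /Ker /= slope0 slope1.
  move=> a b c d; rewrite /= /Ker /= !slopeD !slopeM; exact: trop_twisted.
apply: (@quot_isoalg _ _ _ _ slope_rmorph tdeg).
- by move=> u v.
- by move=> f g; exact: PZ1P.
- move=> u; have [->|[m um]] := slopeP u.
    by exists 0; rewrite !rmorph0.
  by exists (Ymono 0 m); rewrite tdeg_mono; exact: slopeE.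
- move=> f; have [->|[m fm]] := PZ1_normal f.
    by exists 0; rewrite !rmorph0.
  by have [u um] := slope_onto m; exists u; rewrite (PZ1_tdeg fm) tdeg_mono.
move=> k u f uf; rewrite tdegZ -uf; exact: slopeZ.
Qed.

Lemma phi_sub_slope u v : phi (param e +oo%E) (u, v) -> slope u = slope v.
Proof.
move=> /(phi_inftyP _ _ le) uv.
have vu : \forall t \near +oo, v (param e t%:E) = u (param e t%:E).
  by apply: filterS uv.
have [u0|[m [c um]]] := slopeP u; first by rewrite u0 (near_eq_zero le u0 uv).
suff vm : end_slope v e m by rewrite (slopeE vm); apply: slopeE; exists c.
by exists c; apply: filterS2 um vu => t <- ->.
Qed.

End SlopeCongruence.

Lemma slope_parallel (R : realType) (G : par_curve R) (e e' : edge G)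
    (u : rat_par G) :
  len e = +oo%E -> len e' = +oo%E -> parallel_edges e e' ->
  slope e u = slope e' u.
Proof.
move=> le le' ee'; have [->|u0] := pselect (u = 0); first by rewrite !slope0.
have [m um] := rat_end_slope u0 le.
by rewrite (slopeE um) (slopeE (parallel_end_slope u0 le le' ee' um)).
Qed.

(** If e' is not parallel to e, the distance D along the class of e vanishes
    near the end of e' and dominates all functions near the end of e, up to
    constants and powers; modulo I both D and the constants are 1, so every
    element of the quotient is at most 1. *)
Lemma common_I1_parallel (R : realType) (G : par_curve R) (e e' : edge G)
    (I : congruence (rat_par G)) :
  len e = +oo%E -> len e' = +oo%E -> type_I1 I ->
  phi (param e +oo%E) `<=` I -> phi (param e' +oo%E) `<=` I ->
  parallel_edges e e'.
Proof.
move=> le le' hI eI e'I; apply: contrapT => nee'.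
have [u nu1] := type_I1_unbounded hI; apply: nu1; elim/qpi_ind: u => u.
have D1 : qpi I (class_dist le true) = 1.
  apply/qpiP/e'I/(phi_inftyP _ _ le'); near=> t.
  have t0 : 0 <= t by near: t; apply: nbhs_pinfty_ge; exact: num_real.
  have ft : finite_pt (param e' t%:E) by near: t; exact: end_finite_pt.
  rewrite class_distE // rat_oneE //.
  by have -> : in_class e e' = false by apply/asboolPn.
have [->|u0] := pselect (u = 0).
  by rewrite [qpi _ _](_ : _ = 0) // /nle add0r.
have [m [c uE]] := rat_end_slope u0 le.
have [n mn] : exists n : nat, m%:~R <= n%:R :> R by exact: ex_nat_ge.
have : qpi I (u + rat_cst G c * class_dist le true ^+ n) =
       qpi I (rat_cst G c * class_dist le true ^+ n).
  apply/qpiP/eI/(phi_inftyP _ _ le); near=> t.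
  have t0 : 0 <= t by near: t; apply: nbhs_pinfty_ge; exact: num_real.
  have ft : finite_pt (param e t%:E) by near: t; exact: end_finite_pt.
  have dE : class_dist le true (param e t%:E) = t%:E.
    by rewrite class_distE // in_class_refl.
  rewrite [LHS]rpaddE max_r // (near uE t) // (rpmulE (rat_cst _ _) _ ft).
  rewrite rat_cstE // (rat_expE n ft dE) -EFinD lee_fin.
  by rewrite addrC lerD2l ler_wpM2r.
have cst1 : qpi I (rat_cst G c) = 1.
  by rewrite qpiZ; exact: type_I1_cst.
by rewrite qpiD (qpiM I) (qpiX I) cst1 D1 expr1n mulr1.
Unshelve. all: by end_near. Qed.

(** At a finite point, the value of a function above all constants would have
    to be +oo. *)
Lemma type_I2_infinite (R : realType) (G : par_curve R)
    (P : congruence (rat_par G)) (x : curve G) :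
  type_I2 P -> phi x = P -> infty_pt x.
Proof.
move=> hP xP; apply: contrapT => fx.
have PE u v : congr_set P (u, v) <-> u x = v x.
  by rewrite -xP /phi; case: asboolP.
have [w wP] := type_I2_unbounded hP; elim/qpi_ind: w wP => u uP.
have {}uP a : (a%:E <= u x)%E.
  have : qpi P (rat_cst G a + u) = qpi P u by rewrite qpiD qpiZ; exact: uP.
  move=> /qpiP/PE <-; rewrite [X in (_ <= X)%E]rpaddE rat_cstE //.
  by rewrite le_max lexx.
have := rational_finite (rat_funP u).1 fx.
by rewrite -ltey ltNge => /negP; apply; rewrite leye_eq; apply/eqP/eqyP => A _.
Qed.

Theorem corollary5p8 (R : realType) (G : par_curve R)
    (P Q : congruence (rat_par G)) (hP : type_I2 P) (hQ : type_I2 Q) :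
  (exists I : congruence (rat_par G),
     [/\ type_I1 I, P `<=` I & Q `<=` I]) <->
  (exists x y : curve G,
     [/\ phi x = P, phi y = Q &
       exists rho rho' : ray G,
         [/\ parallel rho rho', sval rho x & sval rho' y]]).
Proof.
split=> [[I [hI PI QI]]|[x [y [xP yQ]]]].
  have [e le eP] := type_I2_phi hP; have [e' le' eQ] := type_I2_phi hQ.
  exists (param e +oo%E), (param e' +oo%E); split=> //.
  apply: (common_I1_parallel le le' hI).
    by rewrite eP.
  by rewrite eQ.
have [e le xE] := type_I2_infinite hP xP.
have [e' le' yE] := type_I2_infinite hQ yQ.
rewrite {}xE in xP *; rewrite {}yE in yQ * => ee'.
exists (ker_congruence (slope_rmorph le)).
split; first exact: slope_type_I1.
  by rewrite -xP => -[u v]; exact: phi_sub_slope.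
rewrite -yQ => -[u v] /(phi_sub_slope le') uv.
by rewrite /= /Ker /= !(slope_parallel _ le le' ee').
Qed.
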